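(* Let $M\subset\mathbb{S}^3$ be a translation surface generated by curves $\alpha$ and $\beta$ with curvatures $\kappa_\alpha,\kappa_\beta$ and, when $\kappa_\alpha\not\equiv0$ and/or $\kappa_\beta\not\equiv0$, torsions $\tau_\alpha$ and $\tau_\beta$. Then $M$ is locally isometric to a translation surface $\tilde M\subset\mathbb{R}^3$, generated by curves $\tilde\alpha$ and $\tilde\beta$, whose curvatures and torsions satisfy $\tilde\kappa_\alpha=\kappa_\alpha$, $\tilde\kappa_\beta=\kappa_\beta$, $\tilde\tau_\alpha=\tau_\alpha-1$ and $\tilde\tau_\beta=\tau_\beta+1$, respectively. The reciprocal identification also holds (a translation surface $\tilde M\subset\mathbb{R}^3$ corresponds in the same way to a translation surface $M\subset\mathbb{S}^3$). Moreover, the mean curvatures $\tilde H$ and $H$, of $\tilde M$ and $M$ respectively, satisfy $$\tilde H=H+\frac{\langle T_\alpha,T_\beta\rangle}{\sqrt{1-\langle T_\alpha,T_\beta\rangle^2}}.$$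
   Context: $\mathbb{R}^4$ is identified with the quaternions, ''$\cdot$'' is quaternion multiplication, $\overline{x}$ is conjugation, $\langle\cdot,\cdot\rangle$ is the Euclidean inner product, and $\mathbb{S}^3$ is the group of unit quaternions with the induced metric. A translation surface in $\mathbb{S}^3$ (resp. $\mathbb{R}^3$) is a regular surface locally parametrized by the quaternionic product $\alpha(s)\cdot\beta(t)$ (resp. the sum $\tilde\alpha(s)+\tilde\beta(t)$) of two curves, its generating curves, parametrized by arc length. For an arc length curve $\gamma$ in $\mathbb{S}^3$: $t_\gamma=\gamma'$, $\kappa_\gamma=|\nabla_{\gamma'}\gamma'|$ with $\nabla$ the Levi-Civita connection of $\mathbb{S}^3$; where $\kappa_\gamma\neq0$, $n_\gamma=\kappa_\gamma^{-1}\nabla_{\gamma'}\gamma'$, $b_\gamma\in T_\gamma\mathbb{S}^3$ is the unit vector orthogonal to $t_\gamma,n_\gamma$ with $\det(\gamma,t_\gamma,n_\gamma,b_\gamma)>0$, and the torsion $\tau_\gamma$ is defined by $\nabla_{t_\gamma}n_\gamma=-\kappa_\gamma t_\gamma+\tau_\gamma b_\gamma$. Put $T_\alpha=\overline{\alpha}\cdot t_\alpha$, $N_\alpha=\overline\alpha\cdot n_\alpha$, $B_\alpha=\overline\alpha\cdot b_\alpha$ and $T_\beta=\beta\cdot\overline{t_\beta}$, $N_\beta=\beta\cdot\overline{n_\beta}$, $B_\beta=\beta\cdot\overline{b_\beta}$; these are purely imaginary unit quaternions, regarded as vectors of $\mathbb{R}^3$. Regularity of $\alpha\cdot\beta$ means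 $\langle T_\alpha,T_\beta\rangle\neq\pm1$. In the correspondence, $\tilde\alpha$ is the arc length curve in $\mathbb{R}^3$ with Frenet frame $\{T_\alpha,N_\alpha,B_\alpha\}$ (a straight line in the direction $T_\alpha$ if $\kappa_\alpha\equiv0$) and $\tilde\beta$ the one with Frenet frame $\{T_\beta,N_\beta,B_\beta\}$ (a straight line in the direction $T_\beta$ if $\kappa_\beta\equiv0$); $\tilde\kappa_\alpha,\tilde\tau_\alpha$ and $\tilde\kappa_\beta,\tilde\tau_\beta$ are their curvatures and torsions, read from the Frenet equations $T'=\kappa N$, $N'=-\kappa T+\tau B$, $B'=-\tau N$ of these frames. Mean curvature is half the trace of the second fundamental form and the two are compared at the same parameters $(s,t)$; $H$ is taken with respect to the unit normal $N=\big(\alpha'\cdot\beta'-\langle T_\alpha,T_\beta\rangle\,\alpha\cdot\beta\big)/\sqrt{1-\langle T_\alpha,T_\beta\rangle^2}$ of $M$ in $\mathbb{S}^3$, and $\tilde H$ with respect to $\tilde N=(T_\alpha\times T_\beta)/\sqrt{1-\langle T_\alpha,T_\beta\rangle^2}$.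
   Formalization: T_β, N_β, B_β are replaced by their opposites t_β·conj(β), n_β·conj(β), b_β·conj(β) (the normal N of M is the same vector, written with +⟨T_α,T_β⟩α·β); with the original signs the formula for H̃ fails, e.g. for two great circles with 0<|⟨T_α,T_β⟩|<1. *)

(* Defs.v *)
From mathcomp Require Import all_boot all_order all_algebra.
From mathcomp Require Import all_classical all_reals all_analysis.

Set Implicit Arguments.
Unset Strict Implicit.
Unset Printing Implicit Defensive.

Import Order.TTheory GRing.Theory Num.Theory.
Import numFieldNormedType.Exports.

Local Open Scope classical_set_scope.
Local Open Scope ring_scope.

(* In ring_scope these would be the derivatives of polynomials. *)
Local Notation "f ^` ()" := (derive1 f) : ring_scope.
Local Notation "f ^` ( n )" := (derive1n n f) : ring_scope.

Section Euclidean.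
Context {R : realType}.

Definition dot n (u v : 'rV[R]_n) : R := \sum_i u 0 i * v 0 i.

(* The norm [`|u|] of the library on ['rV[R]_n] is the sup norm; the Euclidean
   norm is needed here. *)
Definition enorm n (u : 'rV[R]_n) : R := Num.sqrt (dot u u).

Definition cross (u v : 'rV[R]_3) : 'rV[R]_3 :=
  \row_(i < 3) [:: u 0 1 * v 0 2%:R - u 0 2%:R * v 0 1;
                   u 0 2%:R * v 0 0 - u 0 0 * v 0 2%:R;
                   u 0 0 * v 0 1 - u 0 1 * v 0 0]`_i.

(* A quaternion a + b i + c j + d k is the row (a, b, c, d), that is, a real
   part followed by an imaginary part in R^3. *)
Definition qre (q : 'rV[R]_4) : R := q 0 0.
Definition qim (q : 'rV[R]_4) : 'rV[R]_3 := rsubmx (q : 'rV[R]_(1 + 3)).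
Definition quat (a : R) (u : 'rV[R]_3) : 'rV[R]_4 :=
  row_mx (a%:M : 'rV[R]_1) u.

Definition qmul (p q : 'rV[R]_4) : 'rV[R]_4 :=
  quat (qre p * qre q - dot (qim p) (qim q))
       (qre p *: qim q + qre q *: qim p + cross (qim p) (qim q)).
Definition qconj (q : 'rV[R]_4) : 'rV[R]_4 := quat (qre q) (- qim q).

End Euclidean.

Section Curves.
Context {R : realType}.

(* Curves are total functions that only matter on an open interval [I]. *)
Definition open_interval (I : set R) : Prop := open I /\ is_interval I.

Definition smooth_on n (I : set R) (g : R -> 'rV[R]_n) : Prop :=
  forall k s, I s -> derivable (g^`(k)) s 1.

Definition arc_length_curve n (I : set R) (g : R -> 'rV[R]_n) : Prop :=
  smooth_on I g /\ forall s, I s -> enorm (g^`() s) = 1.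

Definition in_S3 (I : set R) (g : R -> 'rV[R]_4) : Prop :=
  forall s, I s -> enorm (g s) = 1.

(* The orthogonal projection of R^4 onto the tangent space of S^3 at [x]; the
   Levi-Civita connection of S^3 is the tangential part of the derivative. *)
Definition tanS3 (x v : 'rV[R]_4) : 'rV[R]_4 := v - dot v x *: x.
Definition nablaS3 (g V : R -> 'rV[R]_4) (s : R) : 'rV[R]_4 :=
  tanS3 (g s) (V^`() s).

Definition curvS3 (g : R -> 'rV[R]_4) (s : R) : R := enorm (nablaS3 g g^`() s).
Definition normalS3 (g : R -> 'rV[R]_4) (s : R) : 'rV[R]_4 :=
  (curvS3 g s)^-1 *: nablaS3 g g^`() s.

(* [xget] is definite description: where the curvature is nonzero, exactly one
   vector, respectively number, has the stated property. *)
Definition binormalS3 (g : R -> 'rV[R]_4) (s : R) : 'rV[R]_4 :=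
  xget 0 [set b : 'rV[R]_4 |
    [/\ enorm b = 1,
        dot b (g s) = 0,
        dot b (g^`() s) = 0,
        dot b (normalS3 g s) = 0
      & 0 < \det (\matrix_(i < 4) [:: g s; g^`() s; normalS3 g s; b]`_i)]].
Definition torsS3 (g : R -> 'rV[R]_4) (s : R) : R :=
  xget 0 [set tau : R | nablaS3 g (normalS3 g) s =
                        - curvS3 g s *: g^`() s + tau *: binormalS3 g s].

Definition curvR3 (g : R -> 'rV[R]_3) (s : R) : R := enorm (g^`(2) s).
Definition normalR3 (g : R -> 'rV[R]_3) (s : R) : 'rV[R]_3 :=
  (curvR3 g s)^-1 *: g^`(2) s.
Definition binormalR3 (g : R -> 'rV[R]_3) (s : R) : 'rV[R]_3 :=
  cross (g^`() s) (normalR3 g s).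
Definition torsR3 (g : R -> 'rV[R]_3) (s : R) : R :=
  xget 0 [set tau : R | (normalR3 g)^`() s =
                        - curvR3 g s *: g^`() s + tau *: binormalR3 g s].

End Curves.

Section Surfaces.
Context {R : realType}.

Definition immersion n (D : set (R * R)) (X : R * R -> 'rV[R]_n) : Prop :=
  forall p, D p -> differentiable X p /\ injective ('d X p).

Definition first_form n (X : R * R -> 'rV[R]_n) (p v w : R * R) : R :=
  dot ('d X p v) ('d X p w).

(* A local isometry between the immersed surfaces [X] on [D] and [Y] on [D'],
   both with their induced metrics: a C^1 map of the parameter domains that
   preserves the first fundamental form. Preserving it makes the differential
   invertible, so that [phi] is a local diffeomorphism. *)
Definition local_isometry m n (D : set (R * R)) (X : R * R -> 'rV[R]_m)
    (D' : set (R * R)) (Y : R * R -> 'rV[R]_n) (phi : R * R -> R * R) : Prop :=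
  forall p, D p ->
    [/\ D' (phi p),
        differentiable phi p,
        forall v, {for p, continuous (fun q => 'd phi q v)}
      & forall v w,
          first_form X p v w = first_form Y (phi p) ('d phi p v) ('d phi p w)].

Definition basis2 (i : 'I_2) : R * R := if i == 0 then (1, 0) else (0, 1).

Definition first_mx n (X : R * R -> 'rV[R]_n) (p : R * R) : 'M[R]_2 :=
  \matrix_(i, j) first_form X p (basis2 i) (basis2 j).
Definition second_mxS3 (X nu : R * R -> 'rV[R]_4) (p : R * R) : 'M[R]_2 :=
  \matrix_(i, j)
    dot (tanS3 (X p) ('D_(basis2 i) ('D_(basis2 j) X) p)) (nu p).
Definition second_mxR3 (X nu : R * R -> 'rV[R]_3) (p : R * R) : 'M[R]_2 :=
  \matrix_(i, j) dot ('D_(basis2 i) ('D_(basis2 j) X) p) (nu p).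

(* Half the trace, with respect to the induced metric, of the second
   fundamental form along the unit normal [nu]. *)
Definition mean_curvatureS3 (X nu : R * R -> 'rV[R]_4) (p : R * R) : R :=
  2^-1 * \tr (invmx (first_mx X p) *m second_mxS3 X nu p).
Definition mean_curvatureR3 (X nu : R * R -> 'rV[R]_3) (p : R * R) : R :=
  2^-1 * \tr (invmx (first_mx X p) *m second_mxR3 X nu p).

Definition prod_surface (a b : R -> 'rV[R]_4) (p : R * R) : 'rV[R]_4 :=
  qmul (a p.1) (b p.2).
Definition sum_surface (a b : R -> 'rV[R]_3) (p : R * R) : 'rV[R]_3 :=
  a p.1 + b p.2.

Definition translation_surfaceS3 (I J : set R) (a b : R -> 'rV[R]_4) : Prop :=
  [/\ arc_length_curve I a, in_S3 I a, arc_length_curve J b, in_S3 J b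
    & immersion (I `*` J) (prod_surface a b)].
Definition translation_surfaceR3 (I J : set R) (a b : R -> 'rV[R]_3) : Prop :=
  [/\ arc_length_curve I a, arc_length_curve J b
    & immersion (I `*` J) (sum_surface a b)].

End Surfaces.

Section Correspondence.
Context {R : realType}.

Definition Tl (a : R -> 'rV[R]_4) (s : R) : 'rV[R]_3 :=
  qim (qmul (qconj (a s)) (a^`() s)).
Definition Nl (a : R -> 'rV[R]_4) (s : R) : 'rV[R]_3 :=
  qim (qmul (qconj (a s)) (normalS3 a s)).
Definition Bl (a : R -> 'rV[R]_4) (s : R) : 'rV[R]_3 :=
  qim (qmul (qconj (a s)) (binormalS3 a s)).

(* The frame on the right is [x . conj b], and not its quaternionic conjugate
   [b . conj x], which for these imaginary quaternions is its opposite: only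
   with this sign is [<Tl a, Tr b>] the coefficient F of [a . b], which has to
   be the one of the sum surface for the two to be isometric, and only then is
   the frame positively oriented. *)
Definition Tr (b : R -> 'rV[R]_4) (t : R) : 'rV[R]_3 :=
  qim (qmul (b^`() t) (qconj (b t))).
Definition Nr (b : R -> 'rV[R]_4) (t : R) : 'rV[R]_3 :=
  qim (qmul (normalS3 b t) (qconj (b t))).
Definition Br (b : R -> 'rV[R]_4) (t : R) : 'rV[R]_3 :=
  qim (qmul (binormalS3 b t) (qconj (b t))).

Definition cosT (a b : R -> 'rV[R]_4) (p : R * R) : R :=
  dot (Tl a p.1) (Tr b p.2).

(* With the above sign of [Tr], [- cosT a b p] is the inner product of
   [a' . b'] and [a . b], whence the plus sign in the normal component. *)
Definition unit_normalS3 (a b : R -> 'rV[R]_4) (p : R * R) : 'rV[R]_4 :=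
  (Num.sqrt (1 - cosT a b p ^+ 2))^-1 *:
    (qmul (a^`() p.1) (b^`() p.2) + cosT a b p *: qmul (a p.1) (b p.2)).
Definition unit_normalR3 (a b : R -> 'rV[R]_4) (p : R * R) : 'rV[R]_3 :=
  (Num.sqrt (1 - cosT a b p ^+ 2))^-1 *: cross (Tl a p.1) (Tr b p.2).

Definition corresponding_left (I : set R)
    (a : R -> 'rV[R]_4) (ta : R -> 'rV[R]_3) : Prop :=
  forall s, I s -> ta^`() s = Tl a s /\
    (curvS3 a s != 0 -> normalR3 ta s = Nl a s /\ binormalR3 ta s = Bl a s).
Definition corresponding_right (J : set R)
    (b : R -> 'rV[R]_4) (tb : R -> 'rV[R]_3) : Prop :=
  forall t, J t -> tb^`() t = Tr b t /\
    (curvS3 b t != 0 -> normalR3 tb t = Nr b t /\ binormalR3 tb t = Br b t).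

End Correspondence.

(* Main.v *)
Require Import Defs.
From mathcomp Require Import all_boot all_order all_algebra.
From mathcomp Require Import all_classical all_reals all_analysis.
From mathcomp Require Import ring lra.

(** For [e = 1] (left) or [e = -1] (right), let [smul e a u] be the product of
    [a] with the imaginary quaternion [u] on that side. A unit speed curve [a]
    in [S^3] solves [a' = smul e a T], where [T] is a unit vector field in
    [R^3], and [T' = kappa N] gives [nabla a' = smul e a (kappa N)], so that the
    Frenet frames correspond. Differentiating [smul e a N] adds [e (T x N)] to
    [N'], which shifts the torsion by [e]. Conversely, given [T], the curve in
    [R^3] is a primitive of [T], and the one in [S^3] solves the linear equation
    [a' = smul e a T], which preserves [|a|].

    As [(a T) b] and [a (V b)] are the images of [T] and [V] under the linear
    isometry [u |-> a u b], the first fundamental forms of the product and of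
    the sum agree. So do the second ones, except for the mixed coefficient
    [(a T)(V b) = - <T, V> a b + a (T x V) b], which is [0] for the sum. *)

Set Implicit Arguments.
Unset Strict Implicit.
Unset Printing Implicit Defensive.

Import Order.TTheory GRing.Theory Num.Theory.
Import numFieldNormedType.Exports.

Local Open Scope classical_set_scope.
Local Open Scope ring_scope.

Local Notation "f ^` ()" := (derive1 f) : ring_scope.
Local Notation "f ^` ( n )" := (derive1n n f) : ring_scope.
Local Notation mu := lebesgue_measure.

(** * Primitives and linear differential equations *)

Lemma open_interval_enclose {R : realType} (I : set R) (s t : R) :
  open_interval I -> I s -> I t ->
  exists a b : R, [/\ s \in `]a, b[, t \in `]a, b[ & `[a, b] `<=` I].
Proof.
move=> [oI iI] Is It.
have nb u : I u -> exists2 e : R, 0 < e & I (u - e) /\ I (u + e).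
  move=> Iu; have /nbhs_ballP[e /= e0 eI] : nbhs u I by exact: open_nbhs_nbhs.
  exists (e / 2); first by rewrite divr_gt0.
  by split; apply: eI; rewrite /ball/= ltr_norml; lra.
wlog st : s t Is It / s <= t.
  move=> H; have [/H|/ltW/H] := leP s t; first exact.
  by move=> /(_ It Is)[a [b [? ? ?]]]; exists a, b; split.
have [e e0 [Ie _]] := nb _ Is; have [d d0 [_ Id]] := nb _ It.
exists (s - e), (t + d); split; rewrite ?in_itv/=.
- by rewrite ltrBlDr ltrDl e0/= (le_lt_trans st)// ltrDl.
- by rewrite ltrDl d0 andbT (lt_le_trans _ st)// ltrBlDr ltrDl.
- by move=> x; rewrite /= in_itv/= => /(iI _ _ Ie Id).
Qed.

Lemma continuous_primitive {R : realType} (I : set R) (f : R -> R) (s0 : R) :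
  open_interval I -> I s0 -> (forall s, I s -> {for s, continuous f}) ->
  exists F : R -> R, F s0 = 0 /\ forall s, I s -> is_derive s 1 F (f s).
Proof.
move=> oI Is0 cf.
have int1 (x : R) : \int[mu]_(y in `[x, x]) f y = 0.
  by rewrite set_itv1 Rintegral_set1.
pose F y := \int[mu]_(x in `[s0, y]) f x - \int[mu]_(x in `[y, s0]) f x.
exists F; split; first by rewrite /F subrr.
move=> s Is; have [a [b [sab s0ab abI]]] := open_interval_enclose oI Is Is0.
have intf (c d : R) : `[c, d] `<=` `[a, b] -> mu.-integrable `[c, d] (EFin \o f).
  move=> cd; apply: continuous_compact_integrable; first exact: segment_compact.
  apply: continuous_in_subspaceT => x; rewrite inE => /cd /abI; exact: cf.
pose G y := \int[mu]_(x in `[a, y]) f x.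
have [dG G'] : derivable G s 1 /\ G^`() s = f s.
  apply: (@continuous_FTC1_closed R f a s b); last exact: cf.
  - by rewrite (itvP sab).
  - exact: intf.
  - by rewrite (itvP sab).
have chasles (c d : R) : a < c -> c <= d -> d < b ->
    G d - G c = \int[mu]_(x in `[c, d]) f x.
  move=> ac cd db; rewrite /G Rintegral_itvB ?bnd_simp//; [|apply: intf|exact: ltW].
    rewrite Rintegral_itv_obnd_cbnd//.
    apply: integrableS (intf c d _) => //.
      by apply: subset_itvr => //; rewrite bnd_simp.
    by apply: subset_itv; rewrite bnd_simp ltW.
  by apply: subset_itvl; rewrite bnd_simp ltW.
have FG : \forall y \near s, G y - G s0 = F y.
  near=> y; have /andP[ay yb] : a < y < b.
    by near: y; exact: near_in_itvoo.
  have [s0y|ys0|<-] := ltgtP s0 y.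
  - rewrite /F chasles// ?(itvP s0ab) ?ltW//.
    by rewrite [X in _ - X]( _ : _ = 0) ?subr0// set_itv_ge ?Rintegral_set0// bnd_simp -ltNge.
  - rewrite /F -opprB chasles// ?(itvP s0ab) ?ltW//.
    by rewrite [X in X - _]( _ : _ = 0) ?sub0r// set_itv_ge ?Rintegral_set0// bnd_simp -ltNge.
  - by rewrite /F !int1 subrr subrr.
apply: near_eq_is_derive FG _.
have dG' : is_derive s 1 G (f s) by rewrite -G' derive1E; exact: derivableP.
by apply: is_derive_eq; rewrite subr0.
Unshelve. all: by end_near. Qed.

Lemma is_derive_mxP {R : realFieldType} {V : normedModType R} m n
    (M : V -> 'M[R]_(m, n)) t v (D : 'M[R]_(m, n)) :
  is_derive t v M D <-> forall i j, is_derive t v (fun x => M x i j) (D i j).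
Proof.
split=> [[dM <-] i j|dM].
  by split; [exact: (derivable_mxP M t v).1|rewrite derive_mx// mxE].
have dM' : derivable M t v by apply/(derivable_mxP M t v) => i j; have [] := dM i j.
by split=> //; rewrite derive_mx//; apply/matrixP => i j; rewrite mxE; have [_] := dM i j.
Qed.

Lemma derive_dist_le {R : realType} (f g f' g' : R -> R) (a b s t : R) :
  (forall x, x \in `]a, b[ -> is_derive x 1 f (f' x)) ->
  (forall x, x \in `]a, b[ -> is_derive x 1 g (g' x)) ->
  (forall x, x \in `]a, b[ -> `|f' x| <= g' x) ->
  s \in `]a, b[ -> t \in `]a, b[ -> `|f t - f s| <= `|g t - g s|.
Proof.
move=> df dg fg.
wlog st : s t / s <= t.
  move=> H sab tab; have [/H|/ltW/H] := leP s t; first exact.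
  by rewrite distrC [leRHS]distrC; apply.
move=> sab tab.
have sub x : x \in `[s, t] -> x \in `]a, b[.
  rewrite !in_itv/= => /andP[sx xt].
  by rewrite (lt_le_trans _ sx) ?(itvP sab)// (le_lt_trans xt)// (itvP tab).
have mono (h h' : R -> R) : (forall x, x \in `]a, b[ -> is_derive x 1 h (h' x)) ->
    (forall x, x \in `]a, b[ -> 0 <= h' x) -> h s <= h t.
  move=> dh h0.
  have H1 x : x \in `]s, t[ -> is_derive x 1 h (h' x).
    by move=> xst; apply/dh/sub; exact: subset_itv_oo_cc xst.
  have H2 : {within `[s, t], continuous h}.
    by apply: derivable_within_continuous => x /sub /dh dhx; exact: ex_derive.
  have [c /sub cab H] := MVT_segment st H1 H2.
  by rewrite -subr_ge0 H mulr_ge0 ?h0// subr_ge0.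
have H1 : g s - f s <= g t - f t.
  apply: (mono (fun x => g x - f x) (fun x => g' x - f' x)) => x xab.
    by have := df _ xab; have := dg _ xab => ? ?; exact: is_deriveB.
  by have := fg _ xab; rewrite ler_norml; lra.
have H2 : g s + f s <= g t + f t.
  apply: (mono (fun x => g x + f x) (fun x => g' x + f' x)) => x xab.
    by have := df _ xab; have := dg _ xab => ? ?; exact: is_deriveD.
  by have := fg _ xab; rewrite ler_norml; lra.
by apply: le_trans (ler_norm _); rewrite ler_norml; lra.
Qed.

Lemma is_derive_lim {R : realType} (f f' : nat -> R -> R) (F G : R -> R)
    (e : nat -> R) (a b s : R) :
  e n @[n --> \oo] --> 0 ->
  (forall n x, x \in `]a, b[ -> is_derive x 1 (f n) (f' n x)) ->
  (forall n x, x \in `]a, b[ -> `|f' n x - G x| <= e n) ->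
  (forall n x, x \in `]a, b[ -> `|f n x - F x| <= e n) ->
  s \in `]a, b[ -> is_derive s 1 F (G s).
Proof.
move=> e0 df f'G fF sab.
have small d : 0 < d -> exists n, e n <= d.
  move=> d0; have /cvgrPdist_le/(_ _ d0)[N _ HN] := e0.
  by exists N; have := HN N (leqnn N); rewrite /= sub0r normrN => /(le_trans (ler_norm _)).
have en0 n : 0 <= e n by apply: le_trans (fF n s sab).
have lip n x : x \in `]a, b[ -> `|F x - f n x - (F s - f n s)| <= e n * `|x - s|.
  move=> xab; apply/ler_addgt0Pr => d d0.
  have p0 : 0 < `|x - s| + 2 by rewrite ltr_wpDl.
  have [m em] := small (d / (`|x - s| + 2)) (divr_gt0 d0 p0).
  have H : `|f m x - f n x - (f m s - f n s)| <= (e m + e n) * `|x - s|.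
    have -> : (e m + e n) * `|x - s| = `|(e m + e n) * x - (e m + e n) * s|.
      by rewrite -mulrBr normrM [X in _ = X * _]ger0_norm ?addr_ge0.
    apply: (@derive_dist_le R (fun y => f m y - f n y) (fun y => (e m + e n) * y)
      (fun y => f' m y - f' n y) (cst (e m + e n)) a b s x) => //.
    - by move=> y yab; have := df m _ yab; have := df n _ yab => ? ?; exact: is_deriveB.
    - by move=> y _; apply: is_derive_eq; rewrite /GRing.scale/= mulr1.
    - by move=> y yab; have := f'G m _ yab; have := f'G n _ yab; rewrite /= !ler_norml; lra.
  have H1 := fF m x xab; have H2 := fF m s sab.
  move: em; rewrite ler_pdivlMr// => em.
  rewrite !ler_norml in H H1 H2 *; nra.
have cv : h^-1 *: (F (h *: 1 + s) - F s) @[h --> 0^'] --> G s.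
  apply/cvgrPdist_le => d d0.
  have [n en] := small (d / 4) (divr_gt0 d0 (ltr0n _ 4)).
  have [dfn fns] := df n s sab.
  have cfn : h^-1 *: (f n (h *: 1 + s) - f n s) @[h --> 0^'] --> f' n s.
    by rewrite -fns; exact: dfn.
  move/cvgrPdist_le : cfn => /(_ _ (divr_gt0 d0 (ltr0n _ 4))) cfn.
  near=> h.
  have h0 : h != 0 by near: h; exact: nbhs_dnbhs_neq.
  have hab : h *: 1 + s \in `]a, b[.
    have [] : `|h| < s - a /\ `|h| < b - s.
      by split; near: h; apply: dnbhs0_lt; rewrite subr_gt0 (itvP sab).
    by rewrite in_itv/= [h *: 1]mulr1 !ltr_norml; lra.
  have := lip n _ hab; rewrite addrK.
  rewrite [X in `|X|](_ : _ = h *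
      (h^-1 *: (F (h *: 1 + s) - F s) - h^-1 *: (f n (h *: 1 + s) - f n s))).
    rewrite normrM mulrC [h *: 1]mulr1 ler_pM2r ?normr_gt0// => H1.
    have H2 : `|f' n s - h^-1 *: (f n (h *: 1 + s) - f n s)| <= d / 4 by near: h.
    have H3 := f'G n s sab.
    rewrite [h *: 1]mulr1 in H2 *.
    rewrite !ler_norml in H1 H2 H3 *; lra.
  rewrite mulrBr /GRing.scale/= !mulrA mulfV// !mul1r; ring.
by split; [apply/cvg_ex; exists (G s)|exact/cvg_lim].
Unshelve. all: by end_near. Qed.

Lemma geometric_series_limit {R : realType} (v : nat -> R) (C : R) :
  (forall k, `|v k| <= C / 2 ^+ k) ->
  forall n, `|limn (series v) - series v n| <= 2 * C / 2 ^+ n.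
Proof.
move=> vC.
pose lo n := series v n - 2 * C / 2 ^+ n; pose hi n := series v n + 2 * C / 2 ^+ n.
have p2 n : (2 : R) ^+ n != 0 by rewrite expf_neq0.
have step n : 2 * C / 2 ^+ n.+1 = C / 2 ^+ n by rewrite exprS; field.
have lo_nd : {homo lo : m n / (m <= n)%N >-> m <= n}.
  apply/nondecreasing_seqP => n; rewrite /lo step /series/= big_nat_recr//=.
  by have := vC n; rewrite ler_norml; lra.
have hi_ni : {homo hi : m n / (m <= n)%N >-> n <= m}.
  apply/nonincreasing_seqP => n; rewrite /hi step /series/= big_nat_recr//=.
  by have := vC n; rewrite ler_norml; lra.
have C0 : 0 <= C by have := vC 0; rewrite expr0 divr1; exact: le_trans.
have lohi m n : lo m <= hi n.
  have [mn|/ltW nm] := leP m n.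
    apply: le_trans (lo_nd _ _ mn) _; rewrite /lo /hi lerBlDr -addrA lerDl.
    by rewrite addr_ge0// divr_ge0 ?mulr_ge0// exprn_ge0.
  apply: le_trans (hi_ni _ _ nm); rewrite /lo /hi lerBlDr -addrA lerDl.
  by rewrite addr_ge0// divr_ge0 ?mulr_ge0// exprn_ge0.
pose l := sup (range lo).
have lol n : lo n <= l.
  by apply: ub_le_sup; [exists (hi 0) => _ [m _ <-]|exists n].
have lhi n : l <= hi n.
  by apply: ge_sup; [exists (lo 0); exists 0|move=> _ [m _ <-]].
have vl n : `|l - series v n| <= 2 * C / 2 ^+ n.
  by have := lol n; have := lhi n; rewrite /lo /hi ler_norml; lra.
suff -> : limn (series v) = l by [].
apply: cvg_lim => //; apply/cvgrPdist_le => e e0.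
have h1 : `|2^-1 : R| < 1 by rewrite gtr0_norm ?invf_lt1 ?ltr1n.
have /cvgrPdist_le/(_ _ e0) := @cvg_geometric R (2 * C) 2^-1 h1.
apply: filterS => n /=.
rewrite sub0r normrN => /(le_trans (ler_norm _)).
by rewrite exprVn; apply: le_trans.
Qed.

Lemma mx_entry_norm_le {R : realDomainType} m n (M : 'M[R]_(m, n)) i j : `|M i j| <= `|M|.
Proof.
rewrite [leRHS]/Num.Def.normr/= mx_normrE.
exact: (@le_bigmax _ _ _ _ (fun ij => `|M ij.1 ij.2|) (i, j)).
Qed.

Lemma mx_norm_le {R : realDomainType} m n (M : 'M[R]_(m, n)) (C : R) : 0 <= C ->
  (forall i j, `|M i j| <= C) -> `|M| <= C.
Proof.
by move=> C0 MC; rewrite [leLHS]/Num.Def.normr/= mx_normrE (bigmax_le _ C0).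
Qed.

Lemma mulmx_norm_le {R : realDomainType} n (u : 'rV[R]_n) (A : 'M[R]_n) :
  `|u *m A| <= n%:R * `|A| * `|u|.
Proof.
apply: mx_norm_le => [|i j]; first by rewrite !mulr_ge0.
rewrite mxE (le_trans (ler_norm_sum _ _ _))//.
rewrite (@le_trans _ _ (\sum_(k < n) `|A| * `|u|))//.
  by apply: ler_sum => k _; rewrite normrM mulrC ler_pM// mx_entry_norm_le.
by rewrite sumr_const card_ord -[leLHS]mulr_natl mulrA.
Qed.

Lemma derivable_mulmx {R : realFieldType} {V : normedModType R} m n p
    (M : V -> 'M[R]_(m, n)) (N : V -> 'M[R]_(n, p)) t v :
  derivable M t v -> derivable N t v -> derivable (fun x => M x *m N x) t v.
Proof.
move=> /(derivable_mxP M t v) dM /(derivable_mxP N t v) dN.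
apply/(derivable_mxP _ t v) => i j.
rewrite (_ : (fun x => _) = \sum_k ((fun x => M x i k) * (fun x => N x k j))).
  by apply: derivable_sum => k; apply: derivableM.
by apply/funext => x; rewrite mxE fct_sumE.
Qed.

Lemma derivable_primitive {R : realType} n (I : set R) (f : R -> 'rV[R]_n) (s0 : R) :
  open_interval I -> I s0 -> (forall s, I s -> derivable f s 1) ->
  exists F : R -> 'rV[R]_n, F s0 = 0 /\ forall s, I s -> is_derive s 1 F (f s).
Proof.
move=> oI Is0 df.
have H (i : 'I_n) : exists F : R -> R,
    F s0 = 0 /\ forall s, I s -> is_derive s 1 F (f s 0 i).
  apply: continuous_primitive => // s Is.
  apply/differentiable_continuous/derivable1_diffP.
  exact: (derivable_mxP f s 1).1 (df s Is) 0 i.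
have [F HF] := choice H.
exists (fun s => \row_i F i s); split.
  by apply/rowP => i; rewrite !mxE; have [] := HF i.
move=> s Is; apply/is_derive_mxP => i j.
rewrite (_ : (fun x => _) = F j); last by apply/funext => x; rewrite mxE.
by rewrite ord1; exact: (HF j).2.
Qed.

Lemma linear_ode {R : realType} n (I : set R) (A : R -> 'M[R]_n) (s0 : R) (x0 : 'rV[R]_n) :
  open_interval I -> I s0 -> (forall s, I s -> derivable A s 1) ->
  exists U : R -> 'rV[R]_n,
    U s0 = x0 /\ forall s, I s -> is_derive s 1 U (U s *m A s).
Proof.
move=> oI Is0 dA.
have H (f : R -> 'rV[R]_n) : exists F : R -> 'rV[R]_n,
    (forall s, I s -> derivable f s 1) ->
    F s0 = 0 /\ forall s, I s -> is_derive s 1 F (f s).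
  have [df|ndf] := pselect (forall s, I s -> derivable f s 1); last by exists f.
  by have [F HF] := derivable_primitive oI Is0 df; exists F.
have [P HP] := choice H.
(* The terms of the Peano-Baker series. *)
pose u := fix u k := if k is k'.+1 then P (fun s => u k' s *m A s) else cst x0.
have du k s : I s -> derivable (u k) s 1.
  elim: k s => [|k IHk] s Is; first exact: derivable_cst.
  have duA t : I t -> derivable (fun s => u k s *m A s) t 1.
    by move=> It; apply: derivable_mulmx; [exact: IHk|exact: dA].
  by have [_ /(_ s Is) []] := HP _ duA.
have uS k : u k.+1 s0 = 0 /\ forall s, I s -> is_derive s 1 (u k.+1) (u k s *m A s).
  by apply: HP => t It; apply: derivable_mulmx; [exact: du|exact: dA].
(* With [w = ep + em], the function [K w] is the derivative of [(ep - em) / 2],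
   which is bounded by [w / 2]: each iteration gains a factor [1 / 2]. *)
have bound a b : `[a, b] `<=` I -> s0 \in `]a, b[ -> exists2 C, 0 <= C &
    (forall k s, s \in `]a, b[ -> `|u k s| <= C / 2 ^+ k) /\
    (forall (v : 'rV[R]_n) s, s \in `]a, b[ -> `|v *m A s| <= C * `|v|).
  move=> abI s0ab.
  have cA : {within `[a, b], continuous (fun s => `|A s|)}.
    apply: continuous_in_subspaceT => x; rewrite inE => /abI /dA dAx.
    have cAx : {for x, continuous A} by apply/differentiable_continuous/derivable1_diffP.
    exact: cvg_norm cAx.
  have ab : a <= b by rewrite ltW// (lt_trans (y := s0)) ?(itvP s0ab).
  have [c cab cmax] := EVT_max ab cA.
  pose K : R := n%:R * `|A c|.
  have K0 : 0 <= K by rewrite mulr_ge0.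
  have vA (v : 'rV[R]_n) s : s \in `]a, b[ -> `|v *m A s| <= K * `|v|.
    move=> sab; apply: le_trans (mulmx_norm_le _ _) _.
    rewrite ler_wpM2r// ler_wpM2l//; apply: cmax; exact: subset_itv_oo_cc sab.
  pose ep s := expR (2 * K * (s - s0)); pose em s := expR (- (2 * K * (s - s0))).
  have dep (s : R) : is_derive s 1 ep (2 * K * ep s).
    have Hd : is_derive s 1 (fun s => 2 * K * (s - s0)) (2 * K).
      by apply: is_derive_eq; rewrite /GRing.scale/= subr0 mulr1.
    by rewrite mulrC; exact: (is_derive1_comp (is_derive_expR _) Hd).
  have dem (s : R) : is_derive s 1 em (- (2 * K * em s)).
    have Hd : is_derive s 1 (fun s => - (2 * K * (s - s0))) (- (2 * K)).
      by apply: is_derive_eq; rewrite /GRing.scale/= subr0 mulr1.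
    rewrite (_ : - _ = em s * - (2 * K)); last by ring.
    exact: (is_derive1_comp (is_derive_expR _) Hd).
  have uw k s : s \in `]a, b[ -> `|u k s| <= `|x0| * (ep s + em s) / 2 ^+ k.
    elim: k s => [|k IHk] s sab.
      rewrite /= expr0 divr1 ler_peMr//.
      have := expR_ge1Dx (2 * K * (s - s0)); have := expR_ge1Dx (- (2 * K * (s - s0))).
      by rewrite /ep /em; lra.
    have x0k m : 0 <= `|x0| / 2 ^+ m by rewrite divr_ge0.
    have ep0 t : 0 <= ep t by exact: expR_ge0.
    have em0 t : 0 <= em t by exact: expR_ge0.
    apply: mx_norm_le => [|i j].
      by rewrite mulrAC mulr_ge0// addr_ge0.
    rewrite ord1 {i}.
    pose g (t : R) : R := `|x0| / 2 ^+ k.+1 * (ep t - em t).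
    have dg (t : R) : is_derive t 1 g (K * (`|x0| * (ep t + em t) / 2 ^+ k)).
      apply: is_derive_eq; rewrite /GRing.scale/= exprS; field.
      by rewrite expf_neq0.
    have g0 : g s0 = 0 by rewrite /g /ep /em subrr mulr0 oppr0 subrr mulr0.
    have := @derive_dist_le R (fun t => u k.+1 t 0 j) g (fun t => (u k t *m A t) 0 j)
      (fun t => K * (`|x0| * (ep t + em t) / 2 ^+ k)) a b s0 s.
    rewrite (uS k).1 mxE subr0 g0 subr0.
    move=> /(_ _ _ _ s0ab sab)/le_trans; apply.
    - move=> t tab; have It : I t by apply: abI; exact: subset_itv_oo_cc tab.
      exact: ((is_derive_mxP _ _ _ _).1 ((uS k).2 t It) 0 j).
    - move=> t tab; apply: le_trans (mx_entry_norm_le _ _ _) _.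
      by apply: le_trans (vA _ _ tab) _; rewrite ler_wpM2l// IHk.
    - rewrite normrM ger0_norm// mulrAC -[leRHS]mulrAC mulrAC ler_wpM2l//.
      have := ep0 s; have := em0 s.
      by rewrite ler_norml; lra.
  pose W := `|x0| * (expR (2 * K * (b - a)) + expR (2 * K * (b - a))).
  have W0 : 0 <= W by rewrite mulr_ge0// addr_ge0// expR_ge0.
  exists (W + K); first exact: addr_ge0.
  split=> [k s sab|v s sab].
    apply: le_trans (uw k s sab) _.
    rewrite ler_wpM2r// ?invr_ge0//; apply: (@le_trans _ _ W); last by rewrite lerDl.
    have := itvP s0ab; have := itvP sab => sab' s0ab'.
    rewrite ler_wpM2l// lerD// ler_expR -?mulrN ler_wpM2l// ?mulr_ge0// ?opprB lerB//;
      by rewrite ltW// ?sab' ?s0ab'.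
  by apply: le_trans (vA v s sab) _; rewrite ler_wpM2r// lerDr.
pose S m s := \sum_(k < m) u k s.
pose U s := \row_i limn (series (fun k => u k s 0 i)).
have US m s i : S m s 0 i = series (fun k => u k s 0 i) m.
  by rewrite /S /series/= big_mkord summxE.
have SU a b : `[a, b] `<=` I -> s0 \in `]a, b[ -> exists2 C, 0 <= C &
    forall m s, s \in `]a, b[ -> `|S m s - U s| <= 2 * C / 2 ^+ m /\
      (forall v : 'rV[R]_n, `|v *m A s| <= C * `|v|).
  move=> abI s0ab; have [C C0 [uC AC]] := bound a b abI s0ab.
  exists C => // m s sab; split; last by move=> v; exact: AC.
  apply: mx_norm_le => [|i j]; first by rewrite divr_ge0 ?mulr_ge0.
  rewrite ord1 !mxE US distrC; apply: geometric_series_limit => k.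
  exact: le_trans (mx_entry_norm_le _ _ _) (uC k s sab).
have S0 m : S m.+1 s0 = x0.
  by rewrite /S big_ord_recl big1 ?addr0// => i _; exact: (uS i).1.
have dS m s : I s -> is_derive s 1 (S m.+1) (S m s *m A s).
  move=> Is; rewrite /S (_ : (fun s => _) = \sum_(k < m.+1) u k); last first.
    by apply/funext => t; rewrite fct_sumE.
  rewrite big_ord_recl/= mulmx_suml.
  rewrite -[X in is_derive _ _ _ X]add0r; apply: is_deriveD.
  by apply: is_derive_sum => i; exact: (uS i).2.
have h1 : `|2^-1 : R| < 1 by rewrite gtr0_norm ?invf_lt1 ?ltr1n.
exists U; split.
  have [a [b [_ s0ab abI]]] := open_interval_enclose oI Is0 Is0.
  have [C C0 HC] := SU a b abI s0ab.
  apply/eqP; rewrite -subr_eq0 -normr_eq0 eq_le normr_ge0 andbT.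
  apply/ler_addgt0Pr => d d0; rewrite add0r.
  have /cvgrPdist_le/(_ _ d0)[m _ Hm] := @cvg_geometric R (2 * C) 2^-1 h1.
  have := Hm m.+1 (leqnSn m); rewrite /= sub0r normrN => /(le_trans (ler_norm _)).
  apply: le_trans; have [+ _] := HC m.+1 s0 s0ab.
  by rewrite S0 distrC exprVn.
move=> s Is; apply/is_derive_mxP => i j; rewrite ord1 {i}.
have [a [b [sab s0ab abI]]] := open_interval_enclose oI Is Is0.
have [C C0 HC] := SU a b abI s0ab.
pose e m := (C + 1) * (2 * C) * 2^-1 ^+ m.
apply: (@is_derive_lim R (fun m t => S m.+1 t 0 j) (fun m t => (S m t *m A t) 0 j)
  (fun t => U t 0 j) (fun t => (U t *m A t) 0 j) e a b s) => //.
- exact: cvg_geometric.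
- move=> m t tab; have It : I t by apply: abI; exact: subset_itv_oo_cc tab.
  exact: ((is_derive_mxP _ _ _ _).1 (dS m t It) 0 j).
- move=> m t tab; have [Sm At] := HC m t tab.
  have -> : (S m t *m A t) 0 j - (U t *m A t) 0 j = ((S m t - U t) *m A t) 0 j.
    by rewrite mulmxBl !mxE.
  apply: le_trans (mx_entry_norm_le _ _ _) _; apply: le_trans (At _) _.
  apply: (@le_trans _ _ (C * (2 * C / 2 ^+ m))); first exact: ler_wpM2l.
  rewrite /e exprVn mulrA ler_wpM2r// ?invr_ge0 ?exprn_ge0//.
  by rewrite ler_wpM2r ?mulr_ge0// lerDl.
- move=> m t tab; have [Sm At] := HC m.+1 t tab.
  have -> : S m.+1 t 0 j - U t 0 j = (S m.+1 t - U t) 0 j by rewrite !mxE.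
  apply: le_trans (mx_entry_norm_le _ _ _) _; apply: le_trans Sm _.
  rewrite /e exprVn ler_pM ?mulr_ge0 ?invr_ge0 ?exprn_ge0//.
    by rewrite ler_peMl ?mulr_ge0// lerDr.
  by rewrite lef_pV2 ?posrE ?exprn_gt0// exprS ler_peMl ?exprn_ge0// ler1n.
Qed.

(** * Bilinear maps and smooth curves *)

Section Bilinear.
Context {R : realType} {V W : normedModType R} {m n : nat}.
Variable B : 'rV[R]_m -> 'rV[R]_n -> W.
Hypotheses (Bl : forall v, linear (B^~ v)) (Br : forall u, linear (B u)).

Lemma bilin_expand u v :
  B u v = \sum_i \sum_j (u 0 i * v 0 j) *: B (delta_mx 0 i) (delta_mx 0 j).
Proof.
have B0l w : B 0 w = 0 by have := Bl w (-1) 0 0; rewrite scaler0 addr0 scaleN1r addNr.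
have B0r w : B w 0 = 0 by have := Br w (-1) 0 0; rewrite scaler0 addr0 scaleN1r addNr.
rewrite {1}(row_sum_delta u).
rewrite (big_morph (B^~ v) (id1 := 0) (op1 := +%R)); last 2 first.
- by move=> x y; have := Bl v 1 x y; rewrite !scale1r.
- exact: B0l.
apply: eq_bigr => i _.
have := Bl v (u 0 i) (delta_mx 0 i) 0; rewrite addr0 B0l addr0 => ->.
rewrite {1}(row_sum_delta v).
rewrite (big_morph (B (delta_mx 0 i)) (id1 := 0) (op1 := +%R)); last 2 first.
- by move=> x y; have := Br (delta_mx 0 i) 1 x y; rewrite !scale1r.
- exact: B0r.
rewrite scaler_sumr; apply: eq_bigr => j _.
have := Br (delta_mx 0 i) (v 0 j) (delta_mx 0 j) 0; rewrite addr0 B0r addr0 => ->.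
by rewrite scalerA.
Qed.

Lemma is_deriveZl (k : V -> R) (w : W) (x v : V) (dk : R) :
  is_derive x v k dk -> is_derive x v (fun y => k y *: w) (dk *: w).
Proof.
move=> [dkx <-].
have H : h^-1 *: (k (h *: v + x) *: w - k x *: w) @[h --> 0^'] --> 'D_v k x *: w.
  under eq_fun do rewrite -scalerBl scalerA.
  exact: (cvgZr_tmp (k := 'D_v k x) dkx).
by split; [apply/cvg_ex; eexists; exact: H|exact/cvg_lim].
Qed.

Lemma is_derive_bilin (f : V -> 'rV[R]_m) (g : V -> 'rV[R]_n) x v df dg :
  is_derive x v f df -> is_derive x v g dg ->
  is_derive x v (fun y => B (f y) (g y)) (B df (g x) + B (f x) dg).
Proof.
move=> /is_derive_mxP Hf /is_derive_mxP Hg.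
rewrite (_ : (fun y => _) = \sum_i \sum_j
   (fun y => (f y 0 i * g y 0 j) *: B (delta_mx 0 i) (delta_mx 0 j))); last first.
  apply/funext => y; rewrite bilin_expand fct_sumE; apply: eq_bigr => i _.
  by rewrite fct_sumE.
rewrite !bilin_expand -big_split; apply: is_derive_sum => i.
rewrite -big_split; apply: is_derive_sum => j.
rewrite /= -scalerDl; apply: is_deriveZl.
rewrite addrC mulrC [df 0 i * _]mulrC.
have := Hg 0 j; have := Hf 0 i => ? ?.
by apply: is_derive_eq; rewrite /GRing.scale/= [f x 0 i * _]mulrC.
Qed.

End Bilinear.

Section Ck.
Context {R : realType}.
Implicit Types (I : set R).

Fixpoint Ck (V : normedModType R) (k : nat) I (f : R -> V) : Prop :=
  (forall s, I s -> derivable f s 1) /\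
  (if k is k'.+1 then Ck k' I f^`() else True).

Lemma smooth_onP n I (g : R -> 'rV[R]_n) : smooth_on I g <-> forall k, Ck k I g.
Proof.
split=> [sg k|cg k].
  have : forall j s, I s -> derivable (g^`(j)) s 1 by move=> j s; exact: sg.
  elim: k g {sg} => [|k IHk] g sg /=; first by split=> // s; exact: (sg 0).
  by split=> [s|]; [exact: (sg 0)|apply: IHk => j s Is; rewrite -derive1Sn; exact: sg].
have : forall j, Ck j I g by [].
elim: k g {cg} => [|k IHk] g cg s Is; first exact: (cg 0).1.
by rewrite derive1Sn; apply: IHk => // j; exact: (cg j.+1).2.
Qed.

Lemma derive1_eq_on (V : normedModType R) I (f g : R -> V) s :
  open I -> (forall s, I s -> f s = g s) -> I s -> f^`() s = g^`() s.
Proof.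
move=> oI fg Is; rewrite !derive1E; apply: near_eq_derive.
by near=> t; apply: fg; near: t; exact: open_nbhs_nbhs.
Unshelve. all: by end_near. Qed.

Lemma is_derive_eq_on (V : normedModType R) I (f g : R -> V) s d :
  open I -> (forall s, I s -> f s = g s) -> I s -> is_derive s 1 f d -> is_derive s 1 g d.
Proof.
move=> oI fg Is; apply: near_eq_is_derive.
by near=> t; apply: fg; near: t; exact: open_nbhs_nbhs.
Unshelve. all: by end_near. Qed.

Lemma Ck_eq_on (V : normedModType R) k I (f g : R -> V) :
  open I -> (forall s, I s -> f s = g s) -> Ck k I f -> Ck k I g.
Proof.
move=> oI; elim: k f g => [|k IHk] f g fg /= [df cf]; split=> //.
- by move=> s Is; have [] := is_derive_eq_on oI fg Is (derivableP (df s Is)).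
- by move=> s Is; have [] := is_derive_eq_on oI fg Is (derivableP (df s Is)).
- by apply: IHk cf => s Is; exact: derive1_eq_on fg Is.
Qed.

Lemma derive1_is_derive (V : normedModType R) (f : R -> V) (s : R) d :
  is_derive s 1 f d -> f^`() s = d.
Proof. by move=> [_ <-]; rewrite derive1E. Qed.

Lemma derivable_is_derive (V : normedModType R) (f : R -> V) (s : R) :
  derivable f s 1 -> is_derive s 1 f (f^`() s).
Proof. by rewrite derive1E; exact: derivableP. Qed.

Lemma Ck_is_derive (V : normedModType R) k I (f g : R -> V) : open I ->
  (forall s, I s -> is_derive s 1 f (g s)) -> Ck k I g -> Ck k.+1 I f.
Proof.
move=> oI fg cg; split=> [s /fg[]//|].
by apply: Ck_eq_on cg => // s Is; rewrite (derive1_is_derive (fg s Is)).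
Qed.

Lemma CkW (V : normedModType R) k I (f : R -> V) : Ck k.+1 I f -> Ck k I f.
Proof.
elim: k f => [|k IHk] f [df cf]; first by split.
by split=> //; exact: IHk.
Qed.

Lemma CkD (V : normedModType R) k I (f g : R -> V) : open I ->
  Ck k I f -> Ck k I g -> Ck k I (fun s => f s + g s).
Proof.
move=> oI; elim: k f g => [|k IHk] f g [df cf] [dg cg].
  by split=> // s Is; apply: derivableD; [exact: df|exact: dg].
apply: Ck_is_derive (IHk _ _ cf cg) => // s Is.
have := derivable_is_derive (df s Is); have := derivable_is_derive (dg s Is).
by move=> ? ?; exact: is_deriveD.
Qed.

Lemma Ck_bilin (W : normedModType R) m n (B : 'rV[R]_m -> 'rV[R]_n -> W) k I
    (f : R -> 'rV[R]_m) (g : R -> 'rV[R]_n) : open I ->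
  (forall v, linear (B^~ v)) -> (forall u, linear (B u)) ->
  Ck k I f -> Ck k I g -> Ck k I (fun s => B (f s) (g s)).
Proof.
move=> oI Bl Br; elim: k f g => [|k IHk] f g.
  move=> [df _] [dg _]; split=> // s Is.
  have := derivable_is_derive (df s Is); have := derivable_is_derive (dg s Is) => Hg Hf.
  by have [] := is_derive_bilin Bl Br Hf Hg.
move=> cf cg; have [df cf'] := cf; have [dg cg'] := cg.
apply: Ck_is_derive (CkD _ (IHk _ _ cf' (CkW cg)) (IHk _ _ (CkW cf) cg')) => // s Is.
have := derivable_is_derive (df s Is); have := derivable_is_derive (dg s Is) => Hg Hf.
exact: is_derive_bilin.
Qed.

End Ck.

(** * Quaternion algebra *)

Section Algebra.
Context {R : realType}.
Implicit Types (u v w : 'rV[R]_3) (a b p q : 'rV[R]_4) (e : R).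

Lemma row3P u v : u 0 0 = v 0 0 -> u 0 1 = v 0 1 -> u 0 2%:R = v 0 2%:R -> u = v.
Proof.
move=> h0 h1 h2; apply/rowP => -[[|[|[|//]]] i].
- by rewrite (_ : Ordinal i = 0)//; exact/val_inj.
- by rewrite (_ : Ordinal i = 1)//; exact/val_inj.
- by rewrite (_ : Ordinal i = 2%:R)//; exact/val_inj.
Qed.

Lemma dot3E u v : dot u v = u 0 0 * v 0 0 + u 0 1 * v 0 1 + u 0 2%:R * v 0 2%:R.
Proof.
rewrite /dot !big_ord_recl big_ord0 addr0 addrA.
by congr (_ + u 0 _ * v 0 _ + u 0 _ * v 0 _); exact/val_inj.
Qed.

Lemma cross0E u v : cross u v 0 0 = u 0 1 * v 0 2%:R - u 0 2%:R * v 0 1.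
Proof. by rewrite mxE. Qed.
Lemma cross1E u v : cross u v 0 1 = u 0 2%:R * v 0 0 - u 0 0 * v 0 2%:R.
Proof. by rewrite mxE. Qed.
Lemma cross2E u v : cross u v 0 2%:R = u 0 0 * v 0 1 - u 0 1 * v 0 0.
Proof. by rewrite mxE. Qed.

Definition coordE := (dot3E, cross0E, cross1E, cross2E, mxE).

Lemma dotC n (u v : 'rV[R]_n) : dot u v = dot v u.
Proof. by apply: eq_bigr => i _; rewrite mulrC. Qed.

Lemma dot_linearr n (u : 'rV[R]_n) : linear (dot u : 'rV[R]_n -> R).
Proof.
move=> k x y; rewrite /dot scaler_sumr -big_split; apply: eq_bigr => i _ /=.
by rewrite !mxE /GRing.scale/=; ring.
Qed.

Lemma dot_linearl n (v : 'rV[R]_n) : linear (fun u : 'rV[R]_n => dot u v : R).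
Proof. by move=> k x y; rewrite !(dotC _ v) dot_linearr. Qed.

Lemma dotDr n (u v w : 'rV[R]_n) : dot u (v + w) = dot u v + dot u w.
Proof. by have := dot_linearr u 1 v w; rewrite !scale1r. Qed.

Lemma dotDl n (u v w : 'rV[R]_n) : dot (u + v) w = dot u w + dot v w.
Proof. by rewrite !(dotC _ w) dotDr. Qed.

Lemma dotZr n k (u v : 'rV[R]_n) : dot u (k *: v) = k * dot u v.
Proof. by rewrite /dot mulr_sumr; apply: eq_bigr => i _; rewrite mxE mulrCA. Qed.

Lemma dotZl n k (u v : 'rV[R]_n) : dot (k *: u) v = k * dot u v.
Proof. by rewrite !(dotC _ v) dotZr. Qed.

Lemma dotNl n (u v : 'rV[R]_n) : dot (- u) v = - dot u v.
Proof. by rewrite -scaleN1r dotZl mulN1r. Qed.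

Lemma dot_ge0 n (u : 'rV[R]_n) : 0 <= dot u u.
Proof. by apply: sumr_ge0 => i _; rewrite -expr2 sqr_ge0. Qed.

Lemma dot_eq0 n (u : 'rV[R]_n) : (dot u u == 0) = (u == 0).
Proof.
apply/eqP/eqP => [|->]; last by rewrite /dot big1// => i _; rewrite mxE mul0r.
move=> /psumr_eq0P H; apply/rowP => i; rewrite mxE.
by apply/eqP; rewrite -sqrf_eq0 expr2 H// => j _; rewrite -expr2 sqr_ge0.
Qed.

Lemma dot0l n (u : 'rV[R]_n) : dot 0 u = 0.
Proof. by rewrite -(scale0r 0) dotZl mul0r. Qed.

Lemma enorm_sqr n (u : 'rV[R]_n) : enorm u ^+ 2 = dot u u.
Proof. by rewrite sqr_sqrtr// dot_ge0. Qed.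

Lemma enorm_eq1 n (u : 'rV[R]_n) : enorm u = 1 <-> dot u u = 1.
Proof. by split=> [H|H]; [rewrite -enorm_sqr H expr1n|rewrite /enorm H sqrtr1]. Qed.

Lemma enorm_eq0 n (u : 'rV[R]_n) : (enorm u == 0) = (u == 0).
Proof. by rewrite -dot_eq0 -enorm_sqr sqrf_eq0. Qed.

Lemma quatre (x : R) u : qre (quat x u) = x.
Proof.
rewrite /qre /quat; have -> : (0 : 'I_4) = lshift 3 (0 : 'I_1) by exact/val_inj.
by apply: etrans (row_mxEl _ _ _ _) _; rewrite mxE.
Qed.

Lemma quatim (x : R) u : qim (quat x u) = u.
Proof. exact: row_mxKr. Qed.

Lemma quatP p q : qre p = qre q -> qim p = qim q -> p = q.
Proof.
move=> hr hi; rewrite -[p](@hsubmxK _ 1 1 3) -[q](@hsubmxK _ 1 1 3).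
apply: (f_equal2 (@row_mx _ 1 1 3)) hi.
apply/rowP => i; rewrite !mxE ord1.
by have -> : lshift 3 (0 : 'I_1) = (0 : 'I_4) by exact/val_inj.
Qed.

Lemma qreD p q : qre (p + q) = qre p + qre q. Proof. exact: mxE. Qed.
Lemma qreZ k p : qre (k *: p) = k * qre p. Proof. exact: mxE. Qed.
Lemma qreN p : qre (- p) = - qre p. Proof. exact: mxE. Qed.
Lemma qimD p q : qim (p + q) = qim p + qim q. Proof. exact: linearD. Qed.
Lemma qimZ k p : qim (k *: p) = k *: qim p. Proof. exact: linearZ. Qed.
Lemma qimN p : qim (- p) = - qim p. Proof. exact: linearN. Qed.

Lemma dot4E p q : dot p q = qre p * qre q + dot (qim p) (qim q).
Proof.
rewrite /dot big_ord_recl; congr (_ + _); apply: eq_bigr => i _.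
by rewrite !mxE; congr (p 0 _ * q 0 _); exact/val_inj.
Qed.

Definition quatE := (dot4E, qreD, qreZ, qreN, qimD, qimZ, qimN, quatre, quatim).

(* For an imaginary [u], the product [a . u] if [e = 1] and [u . a] if
   [e = -1]; [pull] is the inverse, which yields [Tl] and [Tr] respectively. *)
Definition smul e a u : 'rV[R]_4 :=
  quat (- dot (qim a) u) (qre a *: u + e *: cross (qim a) u).
Definition pull e a p : 'rV[R]_3 :=
  qre a *: qim p - qre p *: qim a - e *: cross (qim a) (qim p).

Ltac quat_ring := rewrite /qmul /qconj /smul /pull; rewrite ?quatE;
  first [apply: row3P | apply: quatP; rewrite ?quatE; [|apply: row3P] | idtac];
  rewrite ?coordE; ring.

Lemma pull_smul e a u : e ^+ 2 = 1 -> pull e a (smul e a u) = dot a a *: u.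
Proof. by move=> /eqP; rewrite sqrf_eq1 => /orP[]/eqP ->; quat_ring. Qed.

Lemma smul_pull e a p : e ^+ 2 = 1 ->
  smul e a (pull e a p) = dot a a *: p - dot a p *: a.
Proof. by move=> /eqP; rewrite sqrf_eq1 => /orP[]/eqP ->; quat_ring. Qed.

Lemma dot_smul e a u w : e ^+ 2 = 1 ->
  dot (smul e a u) (smul e a w) = dot a a * dot u w.
Proof. by move=> /eqP; rewrite sqrf_eq1 => /orP[]/eqP ->; quat_ring. Qed.

Lemma dot_smul_self e a u : dot (smul e a u) a = 0.
Proof. by quat_ring. Qed.

Lemma smul_smul e a u w : e ^+ 2 = 1 ->
  smul e (smul e a u) w = - dot u w *: a + e *: smul e a (cross u w).
Proof. by move=> /eqP; rewrite sqrf_eq1 => /orP[]/eqP ->; quat_ring. Qed.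

Lemma smul_linearr e a : linear (smul e a).
Proof. by move=> k u w; quat_ring. Qed.

Lemma smul_linearl e u : linear (smul e ^~ u).
Proof. by move=> k p q; quat_ring. Qed.

Lemma smulr0 e a : smul e a 0 = 0.
Proof. by have := smul_linearr e a (-1) 0 0; rewrite scaler0 addr0 scaleN1r addNr. Qed.

Lemma smul0r e u : smul e 0 u = 0.
Proof. by have := smul_linearl e u (-1) 0 0; rewrite scaler0 addr0 scaleN1r addNr. Qed.

Lemma smulDr e a u v : smul e a (u + v) = smul e a u + smul e a v.
Proof. by have := smul_linearr e a 1 u v; rewrite !scale1r. Qed.

Lemma smulZr e a k u : smul e a (k *: u) = k *: smul e a u.
Proof. by have := smul_linearr e a k u 0; rewrite smulr0 !addr0. Qed.

Lemma pull_linearr e a : linear (pull e a).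
Proof. by move=> k u w; quat_ring. Qed.

Lemma pull_linearl e p : linear (pull e ^~ p).
Proof. by move=> k a b; quat_ring. Qed.

Lemma qmul_linearr a : linear (qmul a).
Proof. by move=> k u w; quat_ring. Qed.

Lemma qmul_linearl b : linear (qmul ^~ b).
Proof. by move=> k p q; quat_ring. Qed.

Lemma qmul0l p : qmul 0 p = 0.
Proof. by have := qmul_linearl p (-1) 0 0; rewrite scaler0 addr0 scaleN1r addNr. Qed.

Lemma qmul0r p : qmul p 0 = 0.
Proof. by have := qmul_linearr p (-1) 0 0; rewrite scaler0 addr0 scaleN1r addNr. Qed.

Lemma qmulDl a p q : qmul (a + p) q = qmul a q + qmul p q.
Proof. by have := qmul_linearl q 1 a p; rewrite !scale1r. Qed.

Lemma qmulDr a p q : qmul a (p + q) = qmul a p + qmul a q.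
Proof. by have := qmul_linearr a 1 p q; rewrite !scale1r. Qed.

Lemma qmulZl k p q : qmul (k *: p) q = k *: qmul p q.
Proof. by have := qmul_linearl q k p 0; rewrite qmul0l !addr0. Qed.

Lemma qmulZr k p q : qmul p (k *: q) = k *: qmul p q.
Proof. by have := qmul_linearr p k q 0; rewrite qmul0r !addr0. Qed.

Lemma qmulNl p q : qmul (- p) q = - qmul p q.
Proof. by rewrite -scaleN1r qmulZl scaleN1r. Qed.

Lemma qmulNr p q : qmul p (- q) = - qmul p q.
Proof. by rewrite -scaleN1r qmulZr scaleN1r. Qed.

Lemma pull1E a p : qim (qmul (qconj a) p) = pull 1 a p.
Proof. by quat_ring. Qed.

Lemma pullN1E b p : qim (qmul p (qconj b)) = pull (-1) b p.
Proof. by quat_ring. Qed.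

Lemma qmul_smul a u b : qmul a (smul (-1) b u) = qmul (smul 1 a u) b.
Proof. by quat_ring. Qed.

Lemma dot_qmulr p q b : dot (qmul p b) (qmul q b) = dot p q * dot b b.
Proof. by quat_ring. Qed.

Lemma dot_crossl u v : dot (cross u v) u = 0.
Proof. by rewrite !coordE; ring. Qed.

Lemma dot_crossr u v : dot (cross u v) v = 0.
Proof. by rewrite !coordE; ring. Qed.

Lemma dot_cross_rot u v w :
  dot u (cross v w) = dot w (cross u v).
Proof. by rewrite !coordE; ring. Qed.

Lemma crossvv u : cross u u = 0.
Proof. by apply: row3P; rewrite !coordE; ring. Qed.

Lemma lagrange_identity u v : dot (cross u v) (cross u v) = dot u u * dot v v - dot u v ^+ 2.
Proof. by rewrite ?coordE; ring. Qed.

Lemma frame_expansion u v w (n := cross u v) : dot n n *: w = dot w n *: n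
  + (dot w v * dot u u - dot w u * dot u v) *: v
  + (dot w u * dot v v - dot w v * dot u v) *: u.
Proof. by apply: row3P; rewrite /n ?coordE; ring. Qed.

Lemma det_mx33E (f : nat -> nat -> R) :
  \det (\matrix_(i < 3, j < 3) f i j) =
    f 0 0 * (f 1 1 * f 2 2 - f 1 2 * f 2 1)
  - f 0 1 * (f 1 0 * f 2 2 - f 1 2 * f 2 0)
  + f 0 2 * (f 1 0 * f 2 1 - f 1 1 * f 2 0).
Proof.
rewrite (expand_det_row _ 0) !big_ord_recl big_ord0 /cofactor.
rewrite !(expand_det_row _ 0) !big_ord_recl !big_ord0 /cofactor !det_mx11 !mxE /=.
rewrite /bump /=; ring.
Qed.
Lemma det4E p q a b : \det (\matrix_(i < 4) [:: p; q; a; b]`_i) =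
  qre p * dot (qim q) (cross (qim a) (qim b)) - qre q * dot (qim p) (cross (qim a) (qim b))
  + qre a * dot (qim p) (cross (qim q) (qim b)) - qre b * dot (qim p) (cross (qim q) (qim a)).
Proof.
pose f (i j : nat) := [:: p; q; a; b]`_i 0 (inord j : 'I_4).
have -> : \matrix_(i < 4) [:: p; q; a; b]`_i = \matrix_(i < 4, j < 4) f i j.
  by apply/matrixP => i j; rewrite !mxE /f inord_val.
have minor (k : 'I_4) : \det (row' k (col' 0 (\matrix_(i < 4, j < 4) f i j))) =
    \det (\matrix_(i < 3, j < 3) f (bump k i) j.+1).
  by congr (\det _); apply/matrixP => i j; rewrite !mxE.
rewrite (expand_det_col _ 0) !big_ord_recl big_ord0 /cofactor !mxE !minor.
rewrite !(det_mx33E (fun i j => f (bump _ i) j.+1)) /bump /= /f /=.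
have im (x : 'rV[R]_4) (k : 'I_3) : qim x 0 k = x 0 (inord k.+1).
  by rewrite mxE; congr (x 0 _); apply/val_inj; rewrite /= inordK // ltnS ltn_ord.
have re (x : 'rV[R]_4) : qre x = x 0 (inord 0).
  by rewrite /qre; congr (x 0 _); apply/val_inj; rewrite /= inordK.
rewrite !(dot3E, cross0E, cross1E, cross2E) !im !re /=; ring.
Qed.

Lemma det_smul e a u v w : e ^+ 2 = 1 ->
  \det (\matrix_(i < 4) [:: a; smul e a u; smul e a v; smul e a w]`_i) =
  dot a a ^+ 2 * dot u (cross v w).
Proof. by move=> /eqP; rewrite sqrf_eq1 det4E => /orP[]/eqP ->; quat_ring. Qed.

End Algebra.

(** * Frenet frames *)

Section CurveCalculus.
Context {R : realType}.
Implicit Types (I : set R).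

Lemma is_derive_dot n (f g : R -> 'rV[R]_n) (s : R) df dg :
  is_derive s 1 f df -> is_derive s 1 g dg ->
  is_derive s 1 (fun t => dot (f t) (g t)) (dot df (g s) + dot (f s) dg).
Proof. exact: (is_derive_bilin (@dot_linearl R n) (@dot_linearr R n)). Qed.

Lemma is_derive_smul e (f : R -> 'rV[R]_4) (g : R -> 'rV[R]_3) (s : R) df dg :
  is_derive s 1 f df -> is_derive s 1 g dg ->
  is_derive s 1 (fun t => smul e (f t) (g t)) (smul e df (g s) + smul e (f s) dg).
Proof. exact: (is_derive_bilin (smul_linearl e) (smul_linearr e)). Qed.

Lemma is_derive_qmul (f g : R -> 'rV[R]_4) (s : R) df dg :
  is_derive s 1 f df -> is_derive s 1 g dg ->
  is_derive s 1 (fun t => qmul (f t) (g t)) (qmul df (g s) + qmul (f s) dg).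
Proof. exact: (is_derive_bilin qmul_linearl qmul_linearr). Qed.

Lemma is_derive_dot_cst n I (f g : R -> 'rV[R]_n) (c s : R) df dg :
  open I -> I s -> (forall t, I t -> dot (f t) (g t) = c) ->
  is_derive s 1 f df -> is_derive s 1 g dg -> dot df (g s) + dot (f s) dg = 0.
Proof.
move=> oI Is fgc Hf Hg; have [_ <-] := is_derive_dot Hf Hg.
have Hc : is_derive s 1 (cst c : R -> R) (0 : R) by exact: is_derive_cst.
have fgc' t : I t -> cst c t = dot (f t) (g t) by move=> /fgc.
by have [_ ->] := is_derive_eq_on oI fgc' Is Hc.
Qed.

Lemma is_derive_dot_self_cst n I (f : R -> 'rV[R]_n) (c s : R) df :
  open I -> I s -> (forall t, I t -> dot (f t) (f t) = c) ->
  is_derive s 1 f df -> dot (f s) df = 0.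
Proof.
move=> oI Is ffc Hf; have := is_derive_dot_cst oI Is ffc Hf Hf.
by rewrite dotC -mulr2n => /eqP; rewrite mulrn_eq0 => /eqP.
Qed.

End CurveCalculus.

Section Frenet.
Context {R : realType}.
Variables (I : set R) (T : R -> 'rV[R]_3).
Hypotheses (oI : open I) (CT : forall k, Ck k I T).
Hypothesis T1 : forall s, I s -> dot (T s) (T s) = 1.

Definition frenet_curv (s : R) : R := enorm (T^`() s).
Definition frenet_normal (s : R) : 'rV[R]_3 := (frenet_curv s)^-1 *: T^`() s.
Definition frenet_binormal (s : R) : 'rV[R]_3 := cross (T s) (frenet_normal s).
Definition frenet_tors (s : R) : R := dot (frenet_normal^`() s) (frenet_binormal s).
Local Notation kappa := frenet_curv.
Local Notation N := frenet_normal.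
Local Notation B := frenet_binormal.

Lemma is_derive_tangent s : I s -> is_derive s 1 T (T^`() s).
Proof. by move=> Is; apply: derivable_is_derive; exact: (CT 0).1. Qed.

Lemma is_derive_tangent2 s : I s -> is_derive s 1 T^`() (T^`()^`() s).
Proof. by move=> Is; apply: derivable_is_derive; exact: (CT 1).2.1. Qed.

Lemma frenet_curvN s : T^`() s = kappa s *: N s.
Proof.
have [k0|k0] := eqVneq (kappa s) 0.
  by rewrite k0 scale0r; apply/eqP; rewrite -enorm_eq0; apply/eqP.
by rewrite scalerA mulfV// scale1r.
Qed.

Lemma dot_tangent_normal s : I s -> dot (T s) (N s) = 0.
Proof.
move=> Is; rewrite dotZr (is_derive_dot_self_cst oI Is T1 (is_derive_tangent Is)).
by rewrite mulr0.
Qed.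

Lemma dot_normal_normal s : kappa s != 0 -> dot (N s) (N s) = 1.
Proof.
by move=> k0; rewrite dotZl dotZr -enorm_sqr -/(kappa s); field.
Qed.

Lemma dot_binormal_binormal s : I s -> kappa s != 0 -> dot (B s) (B s) = 1.
Proof.
move=> Is k0; rewrite lagrange_identity T1// dot_normal_normal//.
by rewrite dot_tangent_normal// expr0n subr0 mulr1.
Qed.

Lemma frenet_frame_expansion s w : I s -> kappa s != 0 ->
  w = dot w (B s) *: B s + dot w (N s) *: N s + dot w (T s) *: T s.
Proof.
move=> Is k0; have := frame_expansion (T s) (N s) w.
rewrite /= -/(B s) dot_binormal_binormal// T1// dot_normal_normal// dot_tangent_normal//.
by rewrite !mulr0 !subr0 !mulr1 scale1r.
Qed.

Lemma derivable_curv s : I s -> kappa s != 0 -> derivable kappa s 1.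
Proof.
move=> Is k0; have dT := is_derive_tangent2 Is; have dd := is_derive_dot dT dT.
have k20 : 0 < dot (T^`() s) (T^`() s).
  by rewrite -enorm_sqr exprn_even_gt0.
by have [] := is_derive1_comp (is_derive1_sqrt k20) dd.
Qed.

Lemma is_derive_normal s : I s -> kappa s != 0 -> is_derive s 1 N (N^`() s).
Proof.
move=> Is k0; apply/derivable_is_derive/derivable_mxP => i j.
rewrite (_ : (fun t => _) = (fun t => (kappa t)^-1) * (fun t => T^`() t i j)); last first.
  by apply/funext => t; rewrite mxE.
apply: derivableM; first by apply: derivableV => //; exact: derivable_curv.
by have [/derivable_mxP dT _] := is_derive_tangent2 Is; exact: dT.
Qed.

Lemma frenet_eq s : I s -> kappa s != 0 ->
  N^`() s = - kappa s *: T s + frenet_tors s *: B s.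
Proof.
move=> Is k0; have dN := is_derive_normal Is k0.
rewrite {1}(frenet_frame_expansion (N^`() s) Is k0) addrC.
have -> : dot (N^`() s) (T s) = - kappa s.
  have := is_derive_dot_cst oI Is dot_tangent_normal (is_derive_tangent Is) dN.
  rewrite frenet_curvN dotZl dot_normal_normal// mulr1 dotC => /eqP.
  by rewrite addrC addr_eq0 => /eqP.
suff -> : dot (N^`() s) (N s) = 0 by rewrite scale0r addr0.
have [U [oU Us] Uk] : exists2 U : set R, open U /\ U s & forall t, U t -> kappa t != 0.
  have ck : kappa t @[t --> s] --> kappa s.
    by apply: differentiable_continuous; apply/derivable1_diffP; exact: derivable_curv.
  exists (interior [set t | kappa t != 0]); last exact: interior_subset.
  by split; [exact: open_interior|exact: (cvgr_neq0 _ ck k0)].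
by rewrite dotC (is_derive_dot_self_cst oU Us (fun t Ut => dot_normal_normal (Uk t Ut)) dN).
Qed.

(* Orientation selects one of the two unit vectors orthogonal to the plane of
   [T] and [N]. *)
Lemma binormal_unique s w : I s -> kappa s != 0 ->
  dot w (T s) = 0 -> dot w (N s) = 0 -> dot w w = 1 ->
  0 < dot (T s) (cross (N s) w) -> w = B s.
Proof.
move=> Is k0 wT wN w1 tri.
have := frenet_frame_expansion w Is k0; rewrite wT wN !scale0r !addr0.
rewrite dot_cross_rot -/(B s) in tri.
move=> wE; suff wB : dot w (B s) = 1 by rewrite wE wB scale1r.
have : dot w (B s) ^+ 2 = 1.
  by rewrite -w1 [in RHS]wE dotZl dotZr dot_binormal_binormal// mulr1 expr2.
by move/eqP; rewrite sqrf_eq1 => /orP[/eqP//|/eqP wB]; move: tri; rewrite wB; lra.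
Qed.

Section Euclidean.
Variable g : R -> 'rV[R]_3.
Hypothesis g' : forall s, I s -> g^`() s = T s.

Lemma derive1n2_tangent s : I s -> g^`(2) s = T^`() s.
Proof. exact: derive1_eq_on. Qed.

Lemma curvR3E s : I s -> curvR3 g s = kappa s.
Proof. by move=> Is; rewrite /curvR3 derive1n2_tangent. Qed.

Lemma normalR3E s : I s -> normalR3 g s = N s.
Proof. by move=> Is; rewrite /normalR3 (curvR3E Is) (derive1n2_tangent Is). Qed.

Lemma binormalR3E s : I s -> binormalR3 g s = B s.
Proof. by move=> Is; rewrite /binormalR3 normalR3E// g'. Qed.

Lemma torsR3E s : I s -> kappa s != 0 -> torsR3 g s = frenet_tors s.
Proof.
move=> Is k0; have nE : (normalR3 g)^`() s = N^`() s.
  exact: (derive1_eq_on oI normalR3E Is).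
rewrite /torsR3 nE (curvR3E Is) (g' Is) (binormalR3E Is).
rewrite (frenet_eq Is k0).
apply: xget_unique; first exact: erefl.
move=> tau /addrI /(congr1 (fun u : 'rV[R]_3 => dot u (B s))).
by rewrite /= !dotZl (dot_binormal_binormal Is k0) !mulr1.
Qed.

End Euclidean.

Section Spherical.
Variables (e : R) (a : R -> 'rV[R]_4).
Hypotheses (e2 : e ^+ 2 = 1) (a1 : forall s, I s -> dot (a s) (a s) = 1).
Hypothesis a' : forall s, I s -> is_derive s 1 a (smul e (a s) (T s)).

Lemma derive1_lift s : I s -> a^`() s = smul e (a s) (T s).
Proof. by move=> Is; exact: derive1_is_derive (a' Is). Qed.

Lemma is_derive_lift2 s : I s -> is_derive s 1 a^`() (- a s + smul e (a s) (T^`() s)).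
Proof.
move=> Is; apply: (is_derive_eq_on (f := fun t => smul e (a t) (T t)) oI) => //.
  by move=> t It; rewrite derive1_lift.
have := is_derive_smul e (a' Is) (is_derive_tangent Is).
by rewrite smul_smul// T1// scaleN1r crossvv smulr0 scaler0 addr0.
Qed.

Lemma nabla_tangent s : I s -> nablaS3 a a^`() s = smul e (a s) (T^`() s).
Proof.
move=> Is; rewrite /nablaS3 (derive1_is_derive (is_derive_lift2 Is)) /tanS3.
by rewrite dotDl dotNl a1// dot_smul_self addr0 scaleN1r opprK addrAC addNr add0r.
Qed.

Lemma curvS3E s : I s -> curvS3 a s = kappa s.
Proof. by move=> Is; rewrite /curvS3 nabla_tangent// /enorm dot_smul// a1// mul1r. Qed.

Lemma normalS3E s : I s -> normalS3 a s = smul e (a s) (N s).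
Proof. by move=> Is; rewrite /normalS3 curvS3E// nabla_tangent// -smulZr. Qed.

Lemma binormalS3E s : I s -> kappa s != 0 -> binormalS3 a s = smul e (a s) (B s).
Proof.
move=> Is k0; apply: xget_unique => [|b] /=; rewrite derive1_lift// normalS3E//.
  split.
  - by apply/enorm_eq1; rewrite dot_smul// a1// mul1r dot_binormal_binormal.
  - exact: dot_smul_self.
  - by rewrite dot_smul// a1// mul1r dot_crossl.
  - by rewrite dot_smul// a1// mul1r dot_crossr.
  - rewrite det_smul// a1// expr1n mul1r dot_cross_rot -/(B s).
    by rewrite dot_binormal_binormal.
move=> [/enorm_eq1 b1 ba bT bN].
have bE : b = smul e (a s) (pull e (a s) b).
  by rewrite smul_pull// a1// scale1r dotC ba scale0r subr0.
move: b1 bT bN; rewrite bE !dot_smul// a1// !mul1r => b1 bT bN.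
rewrite det_smul// a1// expr1n mul1r => tri; congr smul.
exact: binormal_unique.
Qed.

Lemma nabla_normal s : I s -> kappa s != 0 ->
  nablaS3 a (normalS3 a) s = smul e (a s) (N^`() s + e *: B s).
Proof.
move=> Is k0; have dn : is_derive s 1 (normalS3 a) (smul e (a s) (N^`() s + e *: B s)).
  apply: (is_derive_eq_on (f := fun t => smul e (a t) (N t)) oI) => //.
    by move=> t It; rewrite normalS3E.
  have := is_derive_smul e (a' Is) (is_derive_normal Is k0).
  by rewrite smul_smul// dot_tangent_normal// oppr0 scale0r add0r -smulZr -smulDr addrC.
by rewrite /nablaS3 (derive1_is_derive dn) /tanS3 dot_smul_self scale0r subr0.
Qed.

Lemma torsS3E s : I s -> kappa s != 0 -> torsS3 a s = frenet_tors s + e.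
Proof.
move=> Is k0; apply: xget_unique => [|tau] /=;
  rewrite nabla_normal// derive1_lift// curvS3E// binormalS3E// frenet_eq//
    -addrA -scalerDl smulDr !smulZr//.
move=> /addrI /(congr1 (fun u : 'rV[R]_4 => dot u (smul e (a s) (B s)))).
by rewrite /= !dotZl dot_smul// a1// dot_binormal_binormal// !mulr1.
Qed.

Lemma pull_lift s : I s -> pull e (a s) (a^`() s) = T s.
Proof. by move=> Is; rewrite derive1_lift// pull_smul// a1// scale1r. Qed.

Lemma pull_normal s : I s -> pull e (a s) (normalS3 a s) = N s.
Proof. by move=> Is; rewrite normalS3E// pull_smul// a1// scale1r. Qed.

Lemma pull_binormal s : I s -> kappa s != 0 -> pull e (a s) (binormalS3 a s) = B s.
Proof. by move=> Is k0; rewrite binormalS3E// pull_smul// a1// scale1r. Qed.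

Lemma lift_arc_length : arc_length_curve I a /\ in_S3 I a.
Proof.
split; last by move=> s Is; apply/enorm_eq1; exact: a1.
split; last by move=> s Is; apply/enorm_eq1; rewrite derive1_lift// dot_smul// a1// T1// mulr1.
apply/smooth_onP => k; elim: k => [|k IHk]; first by split=> // s /a'[].
apply: Ck_is_derive a' _ => //.
apply: Ck_bilin => //; [exact: smul_linearl|exact: smul_linearr].
Qed.

End Spherical.

End Frenet.

(** * Curves with a given tangent *)

Section Lifts.
Context {R : realType}.
Implicit Types (I : set R) (a : R -> 'rV[R]_4) (T : R -> 'rV[R]_3).

(* [a] is a unit speed curve in [S^3] with tangent [T], translated to the
   identity on the left if [e = 1] and on the right if [e = -1]. *)
Definition unit_lift (e : R) I a T : Prop :=
  [/\ forall k, Ck k I T, forall s, I s -> dot (T s) (T s) = 1,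
      forall s, I s -> dot (a s) (a s) = 1
    & forall s, I s -> is_derive s 1 a (smul e (a s) (T s))].

Lemma arc_length_is_derive n I (g : R -> 'rV[R]_n) s :
  arc_length_curve I g -> I s -> is_derive s 1 g (g^`() s).
Proof. by move=> [sg _] Is; apply: derivable_is_derive; exact: (sg 0). Qed.

Lemma arc_length_derive1 n I (g : R -> 'rV[R]_n) : arc_length_curve I g ->
  (forall k, Ck k I g^`()) /\ (forall s, I s -> dot (g^`() s) (g^`() s) = 1).
Proof.
move=> [/smooth_onP cg g1]; split=> [k|s Is]; first exact: (cg k.+1).2.
by apply/enorm_eq1; exact: g1.
Qed.

Lemma arc_length_lift e I a : open I -> e ^+ 2 = 1 ->
  arc_length_curve I a -> in_S3 I a ->
  unit_lift e I a (fun s => pull e (a s) (a^`() s)).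
Proof.
move=> oI e2 al S3a; have [ca' a'1] := arc_length_derive1 al.
have a1 s : I s -> dot (a s) (a s) = 1 by move=> /S3a/enorm_eq1.
have aa' s : I s -> a^`() s = smul e (a s) (pull e (a s) (a^`() s)).
  move=> Is; rewrite smul_pull// a1// scale1r.
  by rewrite (is_derive_dot_self_cst oI Is a1 (arc_length_is_derive al Is)) scale0r subr0.
split=> // [k|s Is|s Is].
- apply: Ck_bilin => //; [exact: pull_linearl|exact: pull_linearr|].
  by have /smooth_onP := al.1; exact.
- by have := a'1 s Is; rewrite {1 2}aa'// dot_smul// a1// mul1r.
- by rewrite -(aa' s Is); exact: (arc_length_is_derive al Is).
Qed.

Lemma tangent_primitive I T : open_interval I ->
  (forall k, Ck k I T) -> (forall s, I s -> dot (T s) (T s) = 1) ->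
  exists g, arc_length_curve I g /\ forall s, I s -> g^`() s = T s.
Proof.
move=> oI cT T1.
have [[s0 Is0]|I0] := pselect (I !=set0); last first.
  have I00 s : ~ I s by move=> Is; apply: I0; exists s.
  by exists T; split=> [|s /I00[]]; split=> [k|] s /I00[].
have [g [_ dg]] := derivable_primitive oI Is0 (cT 0).1.
have g' s : I s -> g^`() s = T s by move=> Is; exact: derive1_is_derive (dg s Is).
exists g; split=> //; split=> [|s Is]; last by apply/enorm_eq1; rewrite g'// T1.
apply/smooth_onP => k; apply: CkW; exact: Ck_is_derive oI.1 dg (cT k).
Qed.

Lemma is_derive_constant (f : R -> R) I s t : open_interval I ->
  (forall x, I x -> is_derive x 1 f 0) -> I s -> I t -> f t = f s.
Proof.
move=> oI df Is It; have [a [b [sab tab abI]]] := open_interval_enclose oI Is It.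
apply/eqP; rewrite -subr_eq0 -normr_le0.
have := @derive_dist_le R f (cst 0) (cst 0) (cst 0) a b s t.
rewrite /= subrr normr0; apply=> //.
by move=> x xab; apply: df; apply: abI; exact: subset_itv_oo_cc xab.
Qed.

Lemma smul_tangent_ode e I T : open_interval I -> (forall k, Ck k I T) ->
  exists a, (forall s, I s -> dot (a s) (a s) = 1) /\
    (forall s, I s -> is_derive s 1 a (smul e (a s) (T s))).
Proof.
move=> oI cT.
have [[s0 Is0]|I0] := pselect (I !=set0); last first.
  by exists (cst 0); split=> s Is; case: I0; exists s.
pose A s := \matrix_(i < 4) smul e (delta_mx 0 i) (T s) : 'M[R]_4.
have AE x s : x *m A s = smul e x (T s).
  rewrite mulmx_sum_row {2}(row_sum_delta x).
  rewrite (big_morph (smul e ^~ (T s)) (id1 := 0) (op1 := +%R)); last 2 first.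
  - by move=> y z; have := smul_linearl e (T s) 1 y z; rewrite !scale1r.
  - exact: smul0r.
  apply: eq_bigr => i _; rewrite rowK.
  by have := smul_linearl e (T s) (x 0 i) (delta_mx 0 i) 0; rewrite smul0r !addr0.
have dA s : I s -> derivable A s 1.
  move=> Is; apply/derivable_mxP => i j.
  have dT := derivable_is_derive ((cT 0).1 s Is).
  have [/derivable_mxP dS _] := is_derive_smul e (is_derive_cst (delta_mx 0 i) s 1) dT.
  rewrite (_ : (fun t => A t i j) = (fun t => smul e (delta_mx 0 i) (T t) 0 j)).
    exact: dS 0 j.
  by apply/funext => t; rewrite mxE.
have [a [as0 da]] := linear_ode (delta_mx 0 0) oI Is0 dA.
have da' s : I s -> is_derive s 1 a (smul e (a s) (T s)).
  by move=> /da; rewrite AE.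
exists a; split=> // s Is.
have -> : dot (a s) (a s) = dot (a s0) (a s0).
  apply: (@is_derive_constant (fun s => dot (a s) (a s)) I s0 s) => // x Ix.
  have := is_derive_dot (da' x Ix) (da' x Ix).
  by rewrite dot_smul_self dotC dot_smul_self addr0.
rewrite as0 /dot (bigD1 0)//= big1 ?addr0 => [|i i0]; rewrite !mxE ?eqxx ?mulr1//.
by rewrite (negbTE i0) andbF mul0r.
Qed.

Lemma lift_of_curve e I (g : R -> 'rV[R]_3) : open_interval I -> e ^+ 2 = 1 ->
  arc_length_curve I g -> exists a, unit_lift e I a g^`().
Proof.
move=> oI e2 al; have [cg g1] := arc_length_derive1 al.
by have [a [a1 da]] := smul_tangent_ode e oI cg; exists a; split.
Qed.

End Lifts.

(** * Translation surfaces *)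

Section PartialDerivatives.
Context {R : realType}.

Lemma derive_fstE (W : normedModType R) (f : R * R -> W) p :
  'D_(basis2 0) f p = (fun s => f (s, p.2))^`() p.1.
Proof.
case: p => s t /=; rewrite derive1E /derive.
set F := (X in lim (X @ _)); set G := (X in _ = lim (X @ _)).
suff -> : F = G by [].
apply/funext => h; rewrite /F /G /=; congr (_ *: (f _ - _)).
by congr pair; rewrite /= /GRing.scale/= mulr0 add0r.
Qed.

Lemma derive_sndE (W : normedModType R) (f : R * R -> W) p :
  'D_(basis2 1) f p = (fun t => f (p.1, t))^`() p.2.
Proof.
case: p => s t /=; rewrite derive1E /derive.
set F := (X in lim (X @ _)); set G := (X in _ = lim (X @ _)).
suff -> : F = G by [].
apply/funext => h; rewrite /F /G /=; congr (_ *: (f _ - _)).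
by congr pair; rewrite /= /GRing.scale/= mulr0 add0r.
Qed.

Lemma diff_partial (W : normedModType R) (f : R * R -> W) p v : differentiable f p ->
  'd f p v = v.1 *: 'D_(basis2 0) f p + v.2 *: 'D_(basis2 1) f p.
Proof.
move=> df; rewrite !deriveE// -!linearZ -linearD; congr ('d f p _).
by case: v => x y; congr pair; rewrite /= /GRing.scale/= ?mulr1 ?mulr0 ?addr0 ?add0r.
Qed.

Lemma differentiable_fst_comp (W : normedModType R) (f : R -> W) (p : R * R) :
  derivable f p.1 1 -> differentiable (fun q => f q.1) p.
Proof.
move=> /derivable1_diffP df; apply: (differentiable_comp (f := fst)) => //.
by apply: (linear_differentiable (f := fst)) => q; exact: cvg_fst.
Qed.

Lemma differentiable_snd_comp (W : normedModType R) (f : R -> W) (p : R * R) :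
  derivable f p.2 1 -> differentiable (fun q => f q.2) p.
Proof.
move=> /derivable1_diffP df; apply: (differentiable_comp (f := snd)) => //.
by apply: (linear_differentiable (f := snd)) => q; exact: cvg_snd.
Qed.

Lemma differentiable_bilin_prod (W : normedModType R) m n
    (B : 'rV[R]_m -> 'rV[R]_n -> W) (f : R -> 'rV[R]_m) (g : R -> 'rV[R]_n) (p : R * R) :
  (forall v, linear (B^~ v)) -> (forall u, linear (B u)) ->
  derivable f p.1 1 -> derivable g p.2 1 ->
  differentiable (fun q => B (f q.1) (g q.2)) p.
Proof.
move=> Bl Br /derivable_mxP df /derivable_mxP dg.
rewrite (_ : (fun q => _) = \sum_i \sum_j (fun q : R * R =>
   (f q.1 0 i * g q.2 0 j) *: B (delta_mx 0 i) (delta_mx 0 j))); last first.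
  apply/funext => q; rewrite (bilin_expand Bl Br) fct_sumE; apply: eq_bigr => i _.
  by rewrite fct_sumE.
apply: differentiable_sum => i; apply: differentiable_sum => j.
apply: differentiableZl.
apply: (@differentiableM _ _ (fun q : R * R => f q.1 0 i) (fun q => g q.2 0 j)).
- exact: (differentiable_fst_comp (df 0 i)).
- exact: (differentiable_snd_comp (dg 0 j)).
Qed.

Lemma mxtrace_invmx_mul2 (M S : 'M[R]_2) (c : R) : 1 - c ^+ 2 != 0 ->
  M 0 0 = 1 -> M 0 1 = c -> M 1 0 = c -> M 1 1 = 1 ->
  \tr (invmx M *m S) = (S 0 0 + S 1 1 - c * (S 0 1 + S 1 0)) / (1 - c ^+ 2).
Proof.
move=> c1 M00 M01 M10 M11.
pose N : 'M[R]_2 := (1 - c ^+ 2)^-1 *: \matrix_(i, j) (if i == j then 1 else - c).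
have ord2 (i : 'I_2) : i = 0 \/ i = 1.
  by case: i => [[|[|//]]] i; [left|right]; exact/val_inj.
have sum2 (F : 'I_2 -> R) : \sum_i F i = F 0 + F 1.
  by rewrite !big_ord_recl big_ord0 addr0; congr (_ + F _); exact/val_inj.
have MN : M *m N = 1%:M.
  apply/matrixP => i j; rewrite mxE sum2 !mxE.
  by have [->|->] := ord2 i; have [->|->] := ord2 j; rewrite /= ?M00 ?M01 ?M10 ?M11; field.
have [Mu _] := mulmx1_unit MN.
have -> : invmx M = N by rewrite -[RHS](mulKmx Mu) MN mulmx1.
by rewrite /mxtrace sum2 !mxE !sum2 !mxE /=; field.
Qed.

End PartialDerivatives.

Section TranslationSurfaces.
Context {R : realType}.
Variables (I J : set R) (a b : R -> 'rV[R]_4) (T V ta tb : R -> 'rV[R]_3).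
Hypotheses (oI : open I) (oJ : open J).
Hypotheses (la : unit_lift 1 I a T) (lb : unit_lift (-1) J b V).
Hypotheses (dta : forall s, I s -> is_derive s 1 ta (T s)).
Hypotheses (dtb : forall t, J t -> is_derive t 1 tb (V t)).
Local Notation X := (prod_surface a b).
Local Notation Y := (sum_surface ta tb).

Let one2 : (1 : R) ^+ 2 = 1. Proof. by rewrite expr1n. Qed.
Let mone2 : (-1 : R) ^+ 2 = 1. Proof. by rewrite sqrrN expr1n. Qed.

(* An isometry from the tangent plane of the sum surface at [p] onto that of
   the product surface. *)
Definition transport (p : R * R) (u : 'rV[R]_3) : 'rV[R]_4 :=
  qmul (smul 1 (a p.1) u) (b p.2).

Lemma transportD p u v : transport p (u + v) = transport p u + transport p v.
Proof. by rewrite /transport smulDr qmulDl. Qed.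

Lemma transportZ p k u : transport p (k *: u) = k *: transport p u.
Proof. by rewrite /transport smulZr qmulZl. Qed.

Lemma dot_transport p u v : I p.1 -> J p.2 ->
  dot (transport p u) (transport p v) = dot u v.
Proof.
move=> Ip Jp; have [_ _ a1 _] := la; have [_ _ b1 _] := lb.
by rewrite dot_qmulr dot_smul// (a1 _ Ip) (b1 _ Jp) mul1r mulr1.
Qed.

Lemma dot_transport_prod p u : dot (transport p u) (X p) = 0.
Proof. by rewrite /X dot_qmulr dot_smul_self mul0r. Qed.

Lemma is_derive_qmulr (f : R -> 'rV[R]_4) (s : R) df y :
  is_derive s 1 f df -> is_derive s 1 (fun s => qmul (f s) y) (qmul df y).
Proof.
move=> Hf; have := is_derive_qmul Hf (is_derive_cst y s 1).
by rewrite qmul0r addr0.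
Qed.

Lemma is_derive_qmull (f : R -> 'rV[R]_4) (s : R) df y :
  is_derive s 1 f df -> is_derive s 1 (fun s => qmul y (f s)) (qmul y df).
Proof.
move=> Hf; have := is_derive_qmul (is_derive_cst y s 1) Hf.
by rewrite qmul0l add0r.
Qed.

Lemma prod_derive_fst p : I p.1 -> 'D_(basis2 0) X p = transport p (T p.1).
Proof.
move=> Ip; have [_ _ _ da] := la; rewrite derive_fstE.
exact: derive1_is_derive (is_derive_qmulr (b p.2) (da _ Ip)).
Qed.

Lemma prod_derive_snd p : J p.2 -> 'D_(basis2 1) X p = transport p (V p.2).
Proof.
move=> Jp; have [_ _ _ db] := lb; rewrite derive_sndE /transport -qmul_smul.
exact: derive1_is_derive (is_derive_qmull (a p.1) (db _ Jp)).
Qed.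

Lemma sum_derive_fst p : I p.1 -> 'D_(basis2 0) Y p = T p.1.
Proof.
move=> Ip; rewrite derive_fstE.
have := is_deriveD (dta Ip) (is_derive_cst (tb p.2) p.1 1).
by rewrite addr0 => /derive1_is_derive.
Qed.

Lemma sum_derive_snd p : J p.2 -> 'D_(basis2 1) Y p = V p.2.
Proof.
move=> Jp; rewrite derive_sndE.
have := is_deriveD (is_derive_cst (ta p.1) p.2 1) (dtb Jp).
by rewrite add0r => /derive1_is_derive.
Qed.

Lemma prod_differentiable p : I p.1 -> J p.2 -> differentiable X p.
Proof.
move=> Ip Jp; have [_ _ _ da] := la; have [_ _ _ db] := lb.
apply: (differentiable_bilin_prod qmul_linearl qmul_linearr).
  by have [] := da _ Ip.
by have [] := db _ Jp.
Qed.

Lemma sum_differentiable p : I p.1 -> J p.2 -> differentiable Y p.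
Proof.
move=> Ip Jp; apply: (@differentiableD _ _ _ (ta \o fst) (tb \o snd)).
  by apply: differentiable_fst_comp; have [] := dta Ip.
by apply: differentiable_snd_comp; have [] := dtb Jp.
Qed.

Lemma sum_diff p v : I p.1 -> J p.2 -> 'd Y p v = v.1 *: T p.1 + v.2 *: V p.2.
Proof.
move=> Ip Jp; rewrite (diff_partial v (sum_differentiable Ip Jp)).
by rewrite sum_derive_fst// sum_derive_snd.
Qed.

Lemma prod_diff p v : I p.1 -> J p.2 -> 'd X p v = transport p ('d Y p v).
Proof.
move=> Ip Jp; rewrite (diff_partial v (prod_differentiable Ip Jp)) (sum_diff v Ip Jp).
by rewrite prod_derive_fst// prod_derive_snd// transportD !transportZ.
Qed.

Lemma first_form_eq p v w : I p.1 -> J p.2 -> first_form X p v w = first_form Y p v w.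
Proof.
move=> Ip Jp; rewrite /first_form (prod_diff v Ip Jp) (prod_diff w Ip Jp).
exact: dot_transport.
Qed.

Lemma transport_inj p : I p.1 -> J p.2 -> injective (transport p).
Proof.
move=> Ip Jp u v uv; apply/eqP; rewrite -subr_eq0 -dot_eq0 -(dot_transport _ _ Ip Jp).
by rewrite -scaleN1r transportD transportZ uv scaleN1r subrr dot_eq0.
Qed.

Lemma immersion_iff : immersion (I `*` J) X <-> immersion (I `*` J) Y.
Proof.
split=> H p [Ip Jp]; have [_ inj] := H p (conj Ip Jp).
  split; first exact: sum_differentiable.
  by move=> v w vw; apply: inj; rewrite (prod_diff v Ip Jp) (prod_diff w Ip Jp) vw.
split; first exact: prod_differentiable.
by move=> v w; rewrite (prod_diff v Ip Jp) (prod_diff w Ip Jp) => /(transport_inj Ip Jp)/inj.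
Qed.

Lemma local_isometry_idfun : local_isometry (I `*` J) X (I `*` J) Y idfun.
Proof.
have did (q v : R * R) : 'd idfun q v = v.
  by have [_ ->] := is_diff_id (q : R * R).
move=> p [Ip Jp]; split=> //.
- move=> v; rewrite (_ : (fun q => 'd idfun q v) = cst v); first exact: cst_continuous.
  exact/funext.
- by move=> v w; rewrite !did first_form_eq.
Qed.

Section MeanCurvature.
Variables (p : R * R) (Ip : I p.1) (Jp : J p.2).
Local Notation c := (dot (T p.1) (V p.2)).
Local Notation n := (cross (T p.1) (V p.2)).

Let Ta1 : dot (T p.1) (T p.1) = 1. Proof. by have [_ + _ _] := la; apply. Qed.
Let Vb1 : dot (V p.2) (V p.2) = 1. Proof. by have [_ + _ _] := lb; apply. Qed.

Lemma immersion_cos_neq1 : immersion (I `*` J) Y -> 1 - c ^+ 2 != 0.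
Proof.
move=> imm; apply/eqP => c2; have [_ inj] := imm p (conj Ip Jp).
have : 'd Y p (1, - c) = 'd Y p (0, 0).
  rewrite !(sum_diff _ Ip Jp) /= !scale0r addr0 scale1r; apply/eqP; rewrite -dot_eq0.
  rewrite !dotDl !dotDr !dotZl !dotZr Ta1 Vb1 (dotC (V _)); apply/eqP; rewrite -c2; ring.
by move=> /inj [/eqP]; rewrite oner_eq0.
Qed.

Lemma first_mxE i j : first_mx X p i j = first_mx Y p i j.
Proof. by rewrite !mxE first_form_eq. Qed.

Lemma sum_first_mx : [/\ first_mx Y p 0 0 = 1, first_mx Y p 0 1 = c,
  first_mx Y p 1 0 = c & first_mx Y p 1 1 = 1].
Proof.
split; rewrite !mxE /first_form !(sum_diff _ Ip Jp) /basis2 /=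
  !(scale0r, scale1r, add0r, addr0)//.
exact: dotC.
Qed.

Lemma derive_fst_eq_on (W : normedModType R) v (f : R * R -> W) (g : R -> W) :
  (forall s, I s -> 'D_v f (s, p.2) = g s) -> 'D_(basis2 0) ('D_v f) p = g^`() p.1.
Proof. by move=> fg; rewrite derive_fstE; exact: (derive1_eq_on oI fg Ip). Qed.

Lemma derive_snd_eq_on (W : normedModType R) v (f : R * R -> W) (g : R -> W) :
  (forall t, J t -> 'D_v f (p.1, t) = g t) -> 'D_(basis2 1) ('D_v f) p = g^`() p.2.
Proof. by move=> fg; rewrite derive_sndE; exact: (derive1_eq_on oJ fg Jp). Qed.

Lemma sum_derive2 : [/\ 'D_(basis2 0) ('D_(basis2 0) Y) p = T^`() p.1,
  'D_(basis2 0) ('D_(basis2 1) Y) p = 0, 'D_(basis2 1) ('D_(basis2 0) Y) p = 0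
  & 'D_(basis2 1) ('D_(basis2 1) Y) p = V^`() p.2].
Proof.
split.
- by apply: derive_fst_eq_on => s Is; rewrite sum_derive_fst.
- rewrite (derive_fst_eq_on (g := cst (V p.2))) ?derive1_cst// => s Is.
  by rewrite sum_derive_snd.
- rewrite (derive_snd_eq_on (g := cst (T p.1))) ?derive1_cst// => t Jt.
  by rewrite sum_derive_fst.
- by apply: derive_snd_eq_on => t Jt; rewrite sum_derive_snd.
Qed.

Lemma prod_derive2 : [/\
  'D_(basis2 0) ('D_(basis2 0) X) p = - X p + transport p (T^`() p.1),
  'D_(basis2 0) ('D_(basis2 1) X) p = - c *: X p + transport p n,
  'D_(basis2 1) ('D_(basis2 0) X) p = - c *: X p + transport p n
  & 'D_(basis2 1) ('D_(basis2 1) X) p = - X p + transport p (V^`() p.2)].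
Proof.
have [CT T1 _ da] := la; have [CV V1 _ db] := lb.
have mixed : qmul (smul 1 (a p.1) (T p.1)) (smul (-1) (b p.2) (V p.2)) =
    - c *: X p + transport p n.
  by rewrite qmul_smul smul_smul// scale1r qmulDl qmulZl.
split.
- rewrite (derive_fst_eq_on (g := fun s => qmul (a^`() s) (b p.2))) => [|s Is].
    have := is_derive_qmulr (b p.2) (is_derive_lift2 oI CT T1 one2 da Ip).
    by move=> /derive1_is_derive ->; rewrite qmulDl qmulNl.
  by rewrite prod_derive_fst// (derive1_lift da Is).
- rewrite -mixed (derive_fst_eq_on
    (g := fun s => qmul (a s) (smul (-1) (b p.2) (V p.2)))) => [|s Is].
    exact: derive1_is_derive (is_derive_qmulr _ (da _ Ip)).
  by rewrite prod_derive_snd//= /transport qmul_smul.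
- rewrite -mixed (derive_snd_eq_on
    (g := fun t => qmul (smul 1 (a p.1) (T p.1)) (b t))) => [|t Jt].
    exact: derive1_is_derive (is_derive_qmull _ (db _ Jp)).
  by rewrite prod_derive_fst.
- rewrite (derive_snd_eq_on (g := fun t => qmul (a p.1) (b^`() t))) => [|t Jt].
    have := is_derive_qmull (a p.1) (is_derive_lift2 oJ CV V1 mone2 db Jp).
    move=> /derive1_is_derive ->.
    by rewrite qmulDr qmulNr qmul_smul.
  by rewrite prod_derive_snd// (derive1_lift db Jt) qmul_smul.
Qed.

Variable r : R.

Lemma dot_tanS3_transport k u :
  dot (tanS3 (X p) (k *: X p + transport p u)) (r *: transport p n) = r * dot u n.
Proof.
have Xn : dot (X p) (transport p n) = 0 by rewrite dotC dot_transport_prod.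
rewrite dotZr /tanS3 dotDl dotNl dotZl Xn mulr0 subr0; congr (_ * _).
by rewrite dotDl dotZl Xn mulr0 add0r (dot_transport _ _ Ip Jp).
Qed.

Lemma mean_curvature_sum nu : nu p = r *: n -> 1 - c ^+ 2 != 0 ->
  mean_curvatureR3 Y nu p =
    2^-1 * (r * (dot (T^`() p.1) n + dot (V^`() p.2) n) / (1 - c ^+ 2)).
Proof.
move=> nup c1; have [M00 M01 M10 M11] := sum_first_mx.
have [D00 D01 D10 D11] := sum_derive2.
have S00 : second_mxR3 Y nu p 0 0 = r * dot (T^`() p.1) n by rewrite mxE D00 nup dotZr.
have S01 : second_mxR3 Y nu p 0 1 = 0 by rewrite mxE D01 dot0l.
have S10 : second_mxR3 Y nu p 1 0 = 0 by rewrite mxE D10 dot0l.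
have S11 : second_mxR3 Y nu p 1 1 = r * dot (V^`() p.2) n by rewrite mxE D11 nup dotZr.
rewrite /mean_curvatureR3 (mxtrace_invmx_mul2 _ c1 M00 M01 M10 M11) S00 S01 S10 S11.
by rewrite addr0 mulr0 subr0 -mulrDr.
Qed.

Lemma mean_curvature_prod nu : nu p = r *: transport p n -> 1 - c ^+ 2 != 0 ->
  mean_curvatureS3 X nu p =
    2^-1 * (r * (dot (T^`() p.1) n + dot (V^`() p.2) n) / (1 - c ^+ 2)) - c * r.
Proof.
move=> nup c1; have [M00 M01 M10 M11] := sum_first_mx.
have [D00 D01 D10 D11] := prod_derive2.
rewrite -!first_mxE in M00 M01 M10 M11.
have nn : dot n n = 1 - c ^+ 2 by rewrite lagrange_identity Ta1 Vb1 mul1r.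
have S00 : second_mxS3 X nu p 0 0 = r * dot (T^`() p.1) n.
  by rewrite mxE D00 nup -scaleN1r dot_tanS3_transport.
have S01 : second_mxS3 X nu p 0 1 = r * (1 - c ^+ 2).
  by rewrite mxE D01 nup dot_tanS3_transport nn.
have S10 : second_mxS3 X nu p 1 0 = r * (1 - c ^+ 2).
  by rewrite mxE D10 nup dot_tanS3_transport nn.
have S11 : second_mxS3 X nu p 1 1 = r * dot (V^`() p.2) n.
  by rewrite mxE D11 nup -scaleN1r dot_tanS3_transport.
rewrite /mean_curvatureS3 (mxtrace_invmx_mul2 _ c1 M00 M01 M10 M11) S00 S01 S10 S11.
move: (dot _ n) (dot _ n) c1 => x y; move: c => z c1; field.
exact: c1.
Qed.

End MeanCurvature.
End TranslationSurfaces.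

Section Correspondence.
Context {R : realType}.

Lemma TlE (a : R -> 'rV[R]_4) s : Tl a s = pull 1 (a s) (a^`() s).
Proof. exact: pull1E. Qed.

Lemma TrE (b : R -> 'rV[R]_4) t : Tr b t = pull (-1) (b t) (b^`() t).
Proof. exact: pullN1E. Qed.

Section OneCurve.
Variables (e : R) (I : set R) (a : R -> 'rV[R]_4) (T g : R -> 'rV[R]_3).
Hypotheses (oI : open I) (e2 : e ^+ 2 = 1).
Hypotheses (la : unit_lift e I a T) (g' : forall s, I s -> g^`() s = T s).

Lemma lift_frames s : I s -> g^`() s = pull e (a s) (a^`() s) /\
  (curvS3 a s != 0 -> normalR3 g s = pull e (a s) (normalS3 a s) /\
                      binormalR3 g s = pull e (a s) (binormalS3 a s)).
Proof.
move=> Is; have [CT T1 a1 da] := la; split.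
  by rewrite (pull_lift e2 a1 da Is) g'.
rewrite (curvS3E oI CT T1 e2 a1 da Is) => k0.
rewrite (normalR3E oI g' Is) (binormalR3E oI g' Is).
by rewrite (pull_normal oI CT T1 e2 a1 da Is) (pull_binormal oI CT T1 e2 a1 da Is k0).
Qed.

Lemma lift_curv_tors s : I s -> curvR3 g s = curvS3 a s /\
  (curvS3 a s != 0 -> torsR3 g s = torsS3 a s - e).
Proof.
move=> Is; have [CT T1 a1 da] := la.
rewrite (curvS3E oI CT T1 e2 a1 da Is) (curvR3E oI g' Is); split=> // k0.
by rewrite (torsR3E oI CT T1 g' Is k0) (torsS3E oI CT T1 e2 a1 da Is k0) addrK.
Qed.

End OneCurve.
End Correspondence.
Unset Implicit Arguments.

Theorem theorem5p1 (R : realType) (I J : set R)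
    (openI : open_interval I) (openJ : open_interval J) :
  [/\ (forall alpha beta : R -> 'rV[R]_4,
         translation_surfaceS3 I J alpha beta ->
         exists talpha tbeta : R -> 'rV[R]_3,
           [/\ translation_surfaceR3 I J talpha tbeta,
               corresponding_left I alpha talpha
             & corresponding_right J beta tbeta]),
      (forall talpha tbeta : R -> 'rV[R]_3,
         translation_surfaceR3 I J talpha tbeta ->
         exists alpha beta : R -> 'rV[R]_4,
           [/\ translation_surfaceS3 I J alpha beta,
               corresponding_left I alpha talpha
             & corresponding_right J beta tbeta])
    & forall (alpha beta : R -> 'rV[R]_4) (talpha tbeta : R -> 'rV[R]_3),
        translation_surfaceS3 I J alpha beta ->
        translation_surfaceR3 I J talpha tbeta ->
        corresponding_left I alpha talpha ->
        corresponding_right J beta tbeta ->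
        [/\ local_isometry (I `*` J) (prod_surface alpha beta)
                           (I `*` J) (sum_surface talpha tbeta) idfun,
            (forall s, I s -> curvR3 talpha s = curvS3 alpha s /\
               (curvS3 alpha s != 0 ->
                  torsR3 talpha s = torsS3 alpha s - 1)),
            (forall t, J t -> curvR3 tbeta t = curvS3 beta t /\
               (curvS3 beta t != 0 ->
                  torsR3 tbeta t = torsS3 beta t + 1))
          & forall p, (I `*` J) p ->
              mean_curvatureR3 (sum_surface talpha tbeta)
                               (unit_normalR3 alpha beta) p
              = mean_curvatureS3 (prod_surface alpha beta)
                                 (unit_normalS3 alpha beta) p
                + cosT alpha beta p / Num.sqrt (1 - cosT alpha beta p ^+ 2)]].
Proof.
have [oI iI] := openI; have [oJ iJ] := openJ.
have one2 : (1 : R) ^+ 2 = 1 by rewrite expr1n.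
have mone2 : (-1 : R) ^+ 2 = 1 by rewrite sqrrN expr1n.
split.
- move=> a b [ala Sa alb Sb imm].
  have la := arc_length_lift oI one2 ala Sa; have lb := arc_length_lift oJ mone2 alb Sb.
  have [CT T1 _ _] := la; have [CV V1 _ _] := lb.
  have [ta [alta ta']] := tangent_primitive openI CT T1.
  have [tb [altb tb']] := tangent_primitive openJ CV V1.
  exists ta, tb; split.
  + split; [exact: alta|exact: altb|].
    apply: (immersion_iff la lb _ _).1 imm => s Is.
      by rewrite -(ta' s Is); exact: (arc_length_is_derive alta Is).
    by rewrite -(tb' s Is); exact: (arc_length_is_derive altb Is).
  + by move=> s Is; rewrite TlE /Nl /Bl !pull1E; exact: (lift_frames oI one2 la ta' Is).
  + by move=> t Jt; rewrite TrE /Nr /Br !pullN1E; exact: (lift_frames oJ mone2 lb tb' Jt).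
- move=> ta tb [alta altb imm].
  have [a la] := lift_of_curve openI one2 alta.
  have [b lb] := lift_of_curve openJ mone2 altb.
  have [CT T1 a1 da] := la; have [CV V1 b1 db] := lb.
  have [ala Sa] := lift_arc_length oI CT T1 one2 a1 da.
  have [alb Sb] := lift_arc_length oJ CV V1 mone2 b1 db.
  exists a, b; split.
  + split; [exact: ala|exact: Sa|exact: alb|exact: Sb|].
    apply: (immersion_iff la lb _ _).2 imm => s Is.
      exact: (arc_length_is_derive alta Is).
    exact: (arc_length_is_derive altb Is).
  + by move=> s Is; rewrite TlE /Nl /Bl !pull1E; apply: (lift_frames oI one2 la _ Is).
  + by move=> t Jt; rewrite TrE /Nr /Br !pullN1E; apply: (lift_frames oJ mone2 lb _ Jt).
- move=> a b ta tb [ala Sa alb Sb immX] [alta altb immY] cl cr.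
  have la := arc_length_lift oI one2 ala Sa; have lb := arc_length_lift oJ mone2 alb Sb.
  have ta' s : I s -> ta^`() s = pull 1 (a s) (a^`() s).
    by move=> /cl[-> _]; rewrite TlE.
  have tb' t : J t -> tb^`() t = pull (-1) (b t) (b^`() t).
    by move=> /cr[-> _]; rewrite TrE.
  have dta s : I s -> is_derive s 1 ta (pull 1 (a s) (a^`() s)).
    by move=> Is; rewrite -(ta' s Is); exact: (arc_length_is_derive alta Is).
  have dtb t : J t -> is_derive t 1 tb (pull (-1) (b t) (b^`() t)).
    by move=> Jt; rewrite -(tb' t Jt); exact: (arc_length_is_derive altb Jt).
  split.
  + exact: local_isometry_idfun la lb dta dtb.
  + by move=> s Is; exact: (lift_curv_tors oI one2 la ta' Is).
  + by move=> t Jt; have := lift_curv_tors oJ mone2 lb tb' Jt; rewrite opprK.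
  + move=> p [Ip Jp].
    have cE : cosT a b p = dot (pull 1 (a p.1) (a^`() p.1)) (pull (-1) (b p.2) (b^`() p.2)).
      by rewrite /cosT TlE TrE.
    have c1 := immersion_cos_neq1 la lb dta dtb Ip Jp immY.
    set r := (Num.sqrt (1 - cosT a b p ^+ 2))^-1.
    have nuY : unit_normalR3 a b p =
        r *: cross (pull 1 (a p.1) (a^`() p.1)) (pull (-1) (b p.2) (b^`() p.2)).
      by rewrite /unit_normalR3 TlE TrE.
    rewrite (mean_curvature_sum oI oJ la lb dta dtb Ip Jp nuY c1).
    have [_ _ _ da] := la; have [_ _ _ db] := lb.
    have nuX : unit_normalS3 a b p = r *: transport a b p
        (cross (pull 1 (a p.1) (a^`() p.1)) (pull (-1) (b p.2) (b^`() p.2))).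
      rewrite /unit_normalS3 -/r; congr (_ *: _).
      rewrite {1}(derive1_lift da Ip) {1}(derive1_lift db Jp) qmul_smul smul_smul// scale1r.
      by rewrite qmulDl qmulZl cE /prod_surface scaleNr addrAC addNr add0r.
    rewrite (mean_curvature_prod oI oJ la lb dta dtb Ip Jp nuX c1).
    by rewrite cE subrK.
Qed.
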